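(* Let $N=1$, $s\in(0,1)$, $L>0$, $P>0$, and $$h_0(x):=\begin{cases} L+P & \text{if } x\le 0,\\ -P & \text{if } x>0.\end{cases}$$ Let $h$ be the selfsimilar very weak solution of the two-phase fractional Stefan problem $\partial_t h+(-\Delta)^s\Phi_2(h)=0$ in $\mathbb{R}\times(0,T)$ with initial data $h_0$, and let $H$ and $U=\Phi_2(H)$ be the corresponding enthalpy and temperature profiles. Then: (a) (Antisymmetry) $U(\xi)=-U(-\xi)$ for all $\xi\in\mathbb{R}$ (hence $H(\xi)=-H(-\xi)+L$ for $\xi\neq 0$). (b) (Interphase and discontinuity) $H$ is discontinuous at $\xi=0$, where it has a jump of size $L$. More precisely: $H(\xi)>L$ if $\xi<0$, $H(\xi)<0$ if $\xi>0$, and $U(\xi)=0$ if and only if $\xi=0$.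
   Context: $\Phi_2(r):=\max\{r-L,0\}+\min\{r,0\}$. For $s\in(0,1)$, $(-\Delta)^s$ is the fractional Laplacian on $\mathbb{R}^N$ (Fourier multiplier $|\xi|^{2s}$). $Q_T:=\mathbb{R}^N\times(0,T)$ with $T>0$. Very weak solution: for $\Phi:\mathbb{R}\to\mathbb{R}$ nondecreasing and locally Lipschitz, $h\in L^\infty(Q_T)$ is a very weak solution of $\partial_t h+(-\Delta)^s\Phi(h)=0$ with initial data $h_0\in L^\infty(\mathbb{R}^N)$ if for all $\psi\in C_c^\infty(\mathbb{R}^N\times[0,T))$, $$\int_0^T\int_{\mathbb{R}^N}\big(h\,\partial_t\psi-\Phi(h)(-\Delta)^s\psi\big)\,dx\,dt+\int_{\mathbb{R}^N}h_0(x)\psi(x,0)\,dx=0.$$ It is known that for every $h_0\in L^\infty(\mathbb{R}^N)$ there exists exactly one very weak solution. Profiles: for the step datum $h_0$ above (invariant under $x\mapsto ax$, $a>0$) the solution is selfsimilar, $h(x,t)=H(xt^{-1/(2s)})$, where the enthalpy profile $H$ is bounded and nonincreasing with limits $L+P$ at $-\infty$ and $-P$ at $+\infty$ (a monotone representative of $H$ is used), and satisfies $-\frac{1}{2s}\xi H'(\xi)+(-\Delta)^s\Phi_2(H)(\xi)=0$ in $\mathcal{D}'(\mathbb{R})$. The temperature profile $U:=\Phi_2(H)$ is continuous and bounded on $\mathbb{R}$ (the continuous representative of $U$ is used). *)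

(* Defs.v *)
From HB Require Import structures.
From mathcomp Require Import all_boot all_order all_algebra.
From mathcomp Require Import complex.
From mathcomp Require Import all_classical all_reals all_analysis.

Set Implicit Arguments.
Unset Strict Implicit.
Unset Printing Implicit Defensive.

Import Order.TTheory GRing.Theory Num.Theory.
Import numFieldNormedType.Exports.

Local Open Scope classical_set_scope.
Local Open Scope complex_scope.
Local Open Scope ring_scope.

(* C^k through directional derivatives: on a finite-dimensional space this is
   the existence and continuity of all partial derivatives of order <= k. *)
Fixpoint Ck (R : realType) (V : normedModType R) (k : nat) (f : V -> R) : Prop :=
  if k is k'.+1 then
    continuous f /\
    forall v : V, (forall x, derivable f x v) /\ Ck k' (fun x => 'D_v f x)
  else continuous f.

Definition smooth (R : realType) (V : normedModType R) (f : V -> R) : Prop :=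
  forall k, Ck k f.

Definition fsupp (R : realType) (V : normedModType R) (f : V -> R) : set V :=
  closure [set x | f x != 0].

(* C_c^oo(O), for O open in V, as functions extended by 0 to V. *)
Definition test_function (R : realType) (V : normedModType R) (O : set V)
    (f : V -> R) : Prop :=
  [/\ smooth f, compact (fsupp f) & fsupp f `<=` O].

(* C_c^oo(R x [0, T[) is the space of restrictions to R x [0, T[ of the elements
   of C_c^oo(R x ]-oo, T[); the values at negative times are irrelevant below. *)
Definition spacetime_test (R : realType) (T : R) (psi : R * R -> R) : Prop :=
  test_function [set p : R * R | p.2 < T] psi.

Definition cis (R : realType) (x : R) : R[i] := cos x +i* sin x.

Definition cintegral (R : realType) (f : R -> R[i]) : R[i] :=
  (\int[@lebesgue_measure R]_x complex.Re (f x)) +i*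
  (\int[@lebesgue_measure R]_x complex.Im (f x)).

Definition fourier (R : realType) (f : R -> R) (xi : R) : R[i] :=
  cintegral (fun x => (f x)%:C * cis (- (x * xi))).

(* The inverse transform below is real for real-valued f, since the symbol is
   real and even; Re only adjusts the type. *)
Definition fraclap (R : realType) (s : R) (f : R -> R) (x : R) : R :=
  complex.Re (((2 * pi)^-1)%:C *
    cintegral (fun xi => (`|xi| `^ (2 * s))%:C * fourier f xi * cis (x * xi))).

Definition QT (R : realType) (T : R) : set (R * R) := setT `*` `]0, T[.

Definition ae_QT (R : realType) (T : R) (A : R * R -> Prop) : Prop :=
  {ae (@lebesgue_measure R \x @lebesgue_measure R)%E, forall p, QT T p -> A p}.

Definition Linfty_QT (R : realType) (T : R) (h : R * R -> R) : Prop :=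
  measurable_fun (QT T) h /\ exists M : R, ae_QT T (fun p => `|h p| <= M).

Definition very_weak_solution (R : realType) (s T : R) (Phi h0 : R -> R)
    (h : R * R -> R) : Prop :=
  Linfty_QT T h /\
  forall psi : R * R -> R, spacetime_test T psi ->
    \int[@lebesgue_measure R]_(t in `]0, T[)
      \int[@lebesgue_measure R]_x
        (h (x, t) * 'D_(0, 1) psi (x, t)
         - Phi (h (x, t)) * fraclap s (fun y => psi (y, t)) x)
    + \int[@lebesgue_measure R]_x (h0 x * psi (x, 0)) = 0.

(* "The" very weak solution with datum h0, as an element of L^oo(Q_T). *)
Definition the_very_weak_solution (R : realType) (s T : R) (Phi h0 : R -> R)
    (h : R * R -> R) : Prop :=
  very_weak_solution s T Phi h0 h /\
  forall g, very_weak_solution s T Phi h0 g -> ae_QT T (fun p => g p = h p).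

Definition Phi2 (R : realType) (L r : R) : R :=
  Num.max (r - L) 0 + Num.min r 0.

Definition step_datum (R : realType) (L P x : R) : R :=
  if x <= 0 then L + P else - P.

(* - (2 s)^-1 xi H' + (-Delta)^s Phi(H) = 0 in D'(R); the first term, tested
   against phi, is (2 s)^-1 int H (xi phi)'. *)
Definition profile_equation (R : realType) (s : R) (Phi H : R -> R) : Prop :=
  forall phi : R -> R, test_function setT phi ->
    \int[@lebesgue_measure R]_xi
      ((2 * s)^-1 * H xi * derive1 (fun x : R => x * phi x) xi
       + Phi (H xi) * fraclap s phi xi) = 0.

Record enthalpy_profile (R : realType) (s T : R) (Phi : R -> R) (l r : R)
    (h : R * R -> R) (H : R -> R) : Prop := EnthalpyProfile {
  profile_selfsimilar :
    ae_QT T (fun p => h p = H (p.1 * p.2 `^ (- (2 * s)^-1)));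
  profile_bounded : bounded_fun H;
  profile_nonincreasing : {homo H : x y / x <= y >-> y <= x};
  profile_limNy : H x @[x --> -oo] --> l;
  profile_limy : H x @[x --> +oo] --> r;
  profile_eq : profile_equation s Phi H }.

(* U is the continuous representative of Phi(H). *)
Record temperature_profile (R : realType) (Phi H U : R -> R) : Prop :=
  TemperatureProfile {
  temperature_ae : {ae @lebesgue_measure R, forall xi, U xi = Phi (H xi)};
  temperature_continuous : continuous U;
  temperature_bounded : bounded_fun U }.

Definition has_jump (R : realType) (H : R -> R) (x d : R) : Prop :=
  exists a b : R,
    [/\ H y @[y --> x^'-] --> a, H y @[y --> x^'+] --> b & a - b = d].

(* Main.v *)
Require Import Defs.
From mathcomp Require Import all_boot all_order all_algebra.
From mathcomp Require Import all_classical all_reals all_analysis.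
From mathcomp Require Import measurable_realfun ring lra.
Import Order.TTheory GRing.Theory Num.Theory.
Import numFieldNormedType.Exports.
Local Open Scope classical_set_scope.
Local Open Scope ring_scope.
Set Implicit Arguments.
Unset Strict Implicit.
Unset Printing Implicit Defensive.

(** Two ideas carry the theorem: a symmetry of the problem, and the nonlocality
    of the fractional Laplacian.

    Antisymmetry. The nonlinearity is odd about L/2, that is
    Phi2(L - r) = - Phi2(r) ([Phi2_sub]), and the step datum satisfies
    h0(x) + h0(-x) = L for x != 0. Therefore L - h(-x,t) is a very weak solution
    with the same datum as h ([very_weak_solution_reflect]), and by uniqueness
    h(x,t) + h(-x,t) = L almost everywhere. In the similarity variable this says
    that U is odd ([temperature_odd]); the exceptional null set disappears
    because U is continuous. Moreover U = Phi2(H) holds at every point, as H is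
    monotone ([temperature_everywhere]).

    Interphase. As U is odd and nonincreasing, what remains is to exclude that U
    vanishes at some b > 0. If it does, U = 0 on [-b,b]. The profile equation is
    then tested with a bump f >= 0 supported in ]0,b[ ([temperature_neg]). The
    drift term is a positive multiple of the integral of H (x f)', which is
    nonnegative since H is nonincreasing and x f >= 0
    ([nonincreasing_integral_derivative_ge0]). In the nonlocal term the points x
    and -x are paired. For x >= b the bump is nearer to x than to -x, so
    (-Delta)^s f(x) < (-Delta)^s f(-x) ([fraclap_antisymmetric_lt]), and
    U(x) <= 0 <= U(-x) with strict inequalities for large x, where H is close to
    -P. Thus the nonlocal term is positive ([odd_pairing_gt0]), and the equation
    is violated. Hence U < 0 on x > 0 and U > 0 on x < 0. Inverting Phi2 gives
    H = U < 0 on the right and H = U + L > L on the left, so the continuity of U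
    produces a jump of size exactly L at 0.

    The analytic input concerns the fractional Laplacian of a test function,
    defined as a Fourier multiplier. Off the support of f it must be shown to be
    minus a positive constant times the integral of f(y) |x-y|^(-1-2s), both for
    its sign and for its decay. The symbol |xi|^(2s) is a constant times the
    integral of (1 - cos(r xi)) r^(-1-2s) over r > 0 ([stable_const_scale]);
    exchanging integrals and inverting the transform gives the singular integral
    ([fraclap_singular_integral]), from which the formulas off the support
    follow. The inversion uses Abel means, for which the Poisson kernel is
    explicit ([cosT_inversion]). The resulting decay provides a bound that is
    integrable and uniform over the time slices of a test function
    ([fraclap_dominated]); with it the integrals in the weak formulation can be
    split and reflected term by term. *)

(** * Domination, limits and positivity for real-valued integrals *)

Section generic.
Context {d} {T : measurableType d} {R : realType} (mu : {measure set T -> \bar R}).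

Lemma dominated_integrable (f g : T -> R) :
  measurable_fun setT f -> (forall x, `|f x| <= g x) ->
  mu.-integrable setT (EFin \o g) -> mu.-integrable setT (EFin \o f).
Proof.
move=> mf fg; apply: le_integrable => //; first exact/measurable_EFinP.
by move=> x _ /=; rewrite lee_fin (le_trans (fg x))// ler_norm.
Qed.

Lemma ae_dominated_integrable (f g : T -> R) :
  measurable_fun setT f -> {ae mu, forall x, `|f x| <= g x} ->
  (forall x, 0 <= g x) ->
  mu.-integrable setT (EFin \o g) -> mu.-integrable setT (EFin \o f).
Proof.
move=> mf fg g0 /integrableP[mg ig]; apply/integrableP; split; first exact/measurable_EFinP.
apply: le_lt_trans ig; apply: ae_ge0_le_integral => //.
- by apply: measurableT_comp => //; exact/measurable_EFinP.
- exact: measurableT_comp.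
- by move: fg; apply: filterS => x h _ /=; rewrite lee_fin (le_trans h)// ler_norm.
Qed.

Lemma Rintegral_ae_eq (f g : T -> R) :
  measurable_fun setT f -> measurable_fun setT g ->
  {ae mu, forall x, f x = g x} ->
  \int[mu]_x f x = \int[mu]_x g x.
Proof.
move=> mf mg fg; congr fine; apply: ae_eq_integral => //.
- exact/measurable_EFinP.
- exact/measurable_EFinP.
by move: fg; apply: filterS => x /= -> _.
Qed.

Lemma cvg_dominated_Rintegral (f_ : nat -> T -> R) (f g : T -> R) :
  (forall n, measurable_fun setT (f_ n)) -> measurable_fun setT f ->
  (forall x, f_ n x @[n --> \oo] --> f x) ->
  (forall n x, `|f_ n x| <= g x) -> mu.-integrable setT (EFin \o g) ->
  \int[mu]_x f_ n x @[n --> \oo] --> \int[mu]_x f x.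
Proof.
move=> mf_ mf ff fg ig.
have [] := @dominated_convergence _ T R mu setT measurableT
  (fun n => EFin \o f_ n) (EFin \o f) (EFin \o g).
- by move=> n; exact/measurable_EFinP.
- exact/measurable_EFinP.
- by apply/aeW => x _ /=; apply: cvg_EFin; [near=> n|exact: ff].
- by [].
- by apply/aeW => x n _ /=; rewrite lee_fin.
move=> intf _; rewrite /Rintegral => h.
apply: fine_cvg; rewrite fineK; first exact: h.
exact: integrable_fin_num.
Unshelve. all: by end_near. Qed.

(** A nonnegative function with vanishing integral is null almost everywhere, so
    it cannot be positive on a set of positive measure. *)
Lemma Rintegral_gt0 (f : T -> R) (E : set T) : measurable E ->
  (0 < mu E)%E -> mu.-integrable setT (EFin \o f) ->
  (forall x, 0 <= f x) -> (forall x, E x -> 0 < f x) ->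
  0 < \int[mu]_x f x.
Proof.
move=> mE E0 intf f0 fE; rewrite lt_neqAle Rintegral_ge0// andbT.
apply/eqP => /esym If0.
have : (\int[mu]_x (f x)%:E = 0)%E.
  rewrite -(fineK (integrable_fin_num _ intf))//=.
  by rewrite -[X in X%:E]/(\int[mu]_x f x) If0.
move=> int0.
have mf : measurable_fun setT (EFin \o f) by exact: measurable_int intf.
have /(ae_eq_integral_abs mu measurableT mf) : (\int[mu]_x `|(EFin \o f) x| = 0)%E.
  by rewrite -int0; apply: eq_integral => x _ /=; rewrite ger0_norm.
move=> [N [mN N0 fN]].
suff : (mu E <= mu N)%E by rewrite N0 leNgt E0.
apply: le_measure; rewrite ?inE// => x Ex; apply: fN => /= /(_ I)[fx0].
by have := fE _ Ex; rewrite fx0 ltxx.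
Qed.

End generic.

(** * Parameter integrals and exchange of the order of integration *)

Section fubini.
Context {d1 d2} {T1 : measurableType d1} {T2 : measurableType d2} {R : realType}.

(** Split F into its positive and negative parts and apply Tonelli to each. *)
Lemma measurable_Rintegral_param (m2 : {sigma_finite_measure set T2 -> \bar R})
    (F : T1 * T2 -> R) :
  measurable_fun setT F ->
  measurable_fun setT (fun v => \int[m2]_y F (v, y)).
Proof.
move=> mF; apply: (@measurableT_comp _ _ _ _ _ _ fine).
  exact: fine_measurable.
have mF' : measurable_fun setT (EFin \o F) by exact/measurable_EFinP.
rewrite (_ : (fun v => _) = (fun v =>
  fubini_F m2 ((EFin \o F)^\+)%E v - fubini_F m2 ((EFin \o F)^\-)%E v)%E); last first.
  apply/funext => v; rewrite [LHS]integralE /fubini_F.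
  by congr (_ - _)%E; apply: eq_integral => y _; rewrite ?funeposE ?funenegE.
apply: emeasurable_funB.
- apply: measurable_fun_fubini_tonelli_F.
  + exact: measurable_funepos.
  + by move=> x; exact: funepos_ge0.
- apply: measurable_fun_fubini_tonelli_F.
  + exact: measurable_funeneg.
  + by move=> x; exact: funeneg_ge0.
Qed.

Context (m1 : {sigma_finite_measure set T1 -> \bar R})
        (m2 : {sigma_finite_measure set T2 -> \bar R}).

(** For almost all x the section of F is integrable; for these x the real-valued
    inner integral and the extended one coincide. *)
Lemma Rintegral_fubini_F (F : T1 * T2 -> R) :
  (m1 \x m2)%E.-integrable setT (EFin \o F) ->
  m1.-integrable setT (EFin \o (fun x => \int[m2]_y F (x, y))) /\
  (\int[m1]_x \int[m2]_y F (x, y) = \int[(m1 \x m2)%E]_z F z).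
Proof.
move=> iF; have mF := measurable_int _ iF.
have h1 := integrable_fubini_F iF.
have ae1 : {ae m1, forall x, setT x ->
  (EFin \o (fun x => \int[m2]_y F (x, y))) x = fubini_F m2 (EFin \o F) x}.
  have := ae_integrable1 iF; apply: filterS => x /= ix _.
  by rewrite /Rintegral fineK// integrable_fin_num.
have m1' : measurable_fun setT (EFin \o (fun x => \int[m2]_y F (x, y))).
  by apply/measurable_EFinP/measurable_Rintegral_param/measurable_EFinP.
split.
  apply/integrableP; split => //.
  move/integrableP : h1 => [mf]; apply: le_lt_trans.
  rewrite le_eqVlt; apply/orP; left; apply/eqP.
  apply: ae_eq_integral => //.
  - exact: measurableT_comp.
  - exact: measurableT_comp.
  by move: ae1; apply: filterS => x h Tx /=; rewrite -h.
rewrite /Rintegral -(integral12_prod_meas1 iF); congr fine.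
by apply: ae_eq_integral => //; exact: measurable_int h1.
Qed.

Lemma integrable_prod_swap (F : T1 * T2 -> R) :
  (m1 \x m2)%E.-integrable setT (EFin \o F) ->
  (m2 \x m1)%E.-integrable setT (EFin \o (fun p => F (p.2, p.1))).
Proof.
move=> iF; have mF := measurable_int _ iF.
have mF' : measurable_fun setT (EFin \o (fun p : T2 * T1 => F (p.2, p.1))).
  apply/measurable_EFinP; apply: (measurableT_comp (f := F)).
    exact/measurable_EFinP.
  by apply: measurable_fun_pair; [exact: measurable_snd|exact: measurable_fst].
apply/integrable12ltyP => //=.
exact: (integrable21ltyP m1 m2 mF).1 iF.
Qed.

Lemma Rintegral_fubini_G (F : T1 * T2 -> R) :
  (m1 \x m2)%E.-integrable setT (EFin \o F) ->
  (\int[m2]_y \int[m1]_x F (x, y) = \int[(m1 \x m2)%E]_z F z).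
Proof.
move=> iF; have mF := measurable_int _ iF.
have iF' := integrable_prod_swap iF.
have h1 := measurable_fubini_G iF.
rewrite /Rintegral -(integral21_prod_meas1 iF); congr fine.
apply: ae_eq_integral => //.
- by apply/measurable_EFinP; apply: (measurableT_comp (fine_measurable measurableT) h1).
have := ae_integrable2 iF; apply: filterS => x /= ix _.
by rewrite fineK// integrable_fin_num.
Qed.

Lemma Rintegral_exchange (F : T1 * T2 -> R) :
  (m1 \x m2)%E.-integrable setT (EFin \o F) ->
  \int[m1]_x \int[m2]_y F (x, y) = \int[m2]_y \int[m1]_x F (x, y).
Proof. by move=> iF; rewrite (Rintegral_fubini_F iF).2 Rintegral_fubini_G. Qed.

Lemma integrable_prodM (a : T1 -> R) (b : T2 -> R) :
  m1.-integrable setT (EFin \o a) -> m2.-integrable setT (EFin \o b) ->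
  (m1 \x m2)%E.-integrable setT (EFin \o (fun p => a p.1 * b p.2)).
Proof.
move=> ia ib.
have ma := measurable_int _ ia; have mb := measurable_int _ ib.
apply/integrable12ltyP => /=.
  apply/measurable_EFinP/measurable_funM.
    by apply: (measurableT_comp (f := a)) => //; exact/measurable_EFinP.
  by apply: (measurableT_comp (f := b)) => //; exact/measurable_EFinP.
rewrite (eq_integral (fun x => `|(a x)%:E| * \int[m2]_y `|(b y)%:E|)%E); last first.
  move=> x _; rewrite -ge0_integralZl//.
    by apply: eq_integral => y _; rewrite /= normrM EFinM.
  exact: measurableT_comp.
have [_ ib'] := integrableP _ _ _ ib; have [_ ia'] := integrableP _ _ _ ia.
have : (\int[m2]_y `|(b y)%:E|)%E \is a fin_num.
  by rewrite ge0_fin_numE ?integral_ge0.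
move=> /fineK <-; rewrite ge0_integralZr ?lee_fin//; last 2 first.
- exact: measurableT_comp.
- by rewrite fine_ge0 ?integral_ge0.
by rewrite muleC lte_mul_pinfty// lee_fin fine_ge0// integral_ge0.
Qed.

End fubini.

(** * Affine changes of variable *)

Section affine.
Context {R : realType}.
Notation mu := (@lebesgue_measure R).

Lemma measurable_affine (a b : R) :
  measurable_fun setT ((fun x => a * x + b) : R -> measurableTypeR R).
Proof. by apply: measurable_funD => //; exact: measurable_funM. Qed.

Let image (a b : R) : {measure set (measurableTypeR R) -> \bar R} :=
  measure_function_pushforward__canonical__measure_function_Measure
    mu (measurable_affine a b).

(** Both sides are measures that agree on half-open intervals, hence on all
    Borel sets. *)
Lemma lebesgue_measure_affine (a b : R) (A : set R) : a != 0 -> measurable A ->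
  mu A = mscale (`|a|%:nng)%R (image a b) A.
Proof.
move=> a0 mA; apply: lebesgue_measure_unique => //=.
move=> ? [[u v]] _ <-.
have [uv|vu] := ltP u v; last first.
  rewrite set_itv_ge ?bnd_simp -?leNgt//.
  by rewrite !measure0.
rewrite /mscale/= /image/= /pushforward.
have aN0 : `|a| != 0 by rewrite normr_eq0.
have -> : mu ((fun x => a * x + b) @^-1` `]u, v]%classic) = ((v - u) / `|a|)%:E.
  have [a_gt0|a_lt0|/eqP] := ltgtP 0 a; last by rewrite eq_sym (negbTE a0).
  - rewrite (_ : _ @^-1` _ = `](u - b) / a, (v - b) / a]%classic); last first.
      apply/seteqP; split => x /=; rewrite !in_itv/= ltr_pdivrMr// ler_pdivlMr//;
      by rewrite ltrBlDr lerBrDr (mulrC x).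
    rewrite lebesgue_measure_itv/= lte_fin ltr_pM2r ?invr_gt0// ltrD2r uv.
    by rewrite -EFinD gtr0_norm//; congr EFin; field; rewrite gt_eqF.
  - rewrite (_ : _ @^-1` _ = `[(v - b) / a, (u - b) / a[%classic); last first.
      apply/seteqP; split => x /=; rewrite !in_itv/= ler_ndivrMr// ltr_ndivlMr//;
      by rewrite ltrBlDr lerBrDr (mulrC x) andbC.
    rewrite lebesgue_measure_itv/= lte_fin ltr_nM2r ?invr_lt0// ltrD2r uv.
    by rewrite -EFinD ltr0_norm//; congr EFin; field; rewrite lt_eqF.
rewrite lebesgue_measure_itv/= lte_fin uv -EFinD -EFinM; congr EFin.
by field.
Qed.

Lemma ge0_integral_affine (a b : R) (f : R -> \bar R) : a != 0 ->
  measurable_fun setT f -> (forall x, (0 <= f x)%E) ->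
  (\int[mu]_x f x = `|a|%:E * \int[mu]_x f (a * x + b)%R)%E.
Proof.
move=> a0 mf f0.
transitivity (\int[mscale (`|a|%:nng)%R (image a b)]_x f x)%E.
  by apply: eq_measure_integral => //= A mA _; exact: lebesgue_measure_affine.
rewrite ge0_integral_mscale//=; congr (_ * _)%E.
by rewrite ge0_integral_pushforward//; exact: measurable_affine.
Qed.

Lemma integrable_affine (a b : R) (f : R -> R) : a != 0 ->
  mu.-integrable setT (EFin \o f) ->
  mu.-integrable setT (EFin \o (fun x => f (a * x + b))).
Proof.
move=> a0 /integrableP[mf iff].
have mg : measurable_fun setT (fun x => f (a * x + b)).
  apply: (measurableT_comp (f := f)) => //; first exact/measurable_EFinP.
  exact: measurable_affine.
apply/integrableP; split; first exact/measurable_EFinP.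
have := @ge0_integral_affine a b (fun x => `|(f x)%:E|%E) a0.
move=> h; move: iff; rewrite /= h//; last exact: measurableT_comp.
rewrite -[X in (_ < X -> _)%E](_ : (`|a|%:E * +oo = +oo)%E).
  by rewrite lte_pmul2l// lte_fin normr_gt0.
by rewrite gt0_muley// lte_fin normr_gt0.
Qed.

Lemma Rintegral_affine (a b : R) (f : R -> R) : a != 0 ->
  mu.-integrable setT (EFin \o f) ->
  \int[mu]_x f x = `|a| * \int[mu]_x f (a * x + b).
Proof.
move=> a0 iff; have mf := measurable_int _ iff.
have ig := integrable_affine b a0 iff.
rewrite /Rintegral (_ : \int[mu]_x (f x)%:E =
  `|a|%:E * \int[mu]_x (f (a * x + b))%:E)%E; last first.
  pose g := EFin \o (fun x => f (a * x + b)).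
  have ep : (\int[mu]_x (EFin \o f)^\+ x = `|a|%:E * \int[mu]_x g^\+ x)%E.
    rewrite (@ge0_integral_affine a b)//; last exact: measurable_funepos.
    by congr (_ * _)%E; apply: eq_integral => x _; rewrite !funeposE.
  have en : (\int[mu]_x (EFin \o f)^\- x = `|a|%:E * \int[mu]_x g^\- x)%E.
    rewrite (@ge0_integral_affine a b)//; last exact: measurable_funeneg.
    by congr (_ * _)%E; apply: eq_integral => x _; rewrite !funenegE.
  rewrite [LHS]integralE ep en -/g.
  have -> : (\int[mu]_x g x = \int[mu]_x g^\+ x - \int[mu]_x g^\- x)%E by exact: integralE.
  apply/esym/muleBr => //.
  apply: fin_num_adde_defr.
  exact: (integrable_pos_fin_num measurableT ig).
rewrite fineM//.
exact: (integrable_fin_num measurableT ig).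
Qed.

Lemma integrable_reflect (f : R -> R) :
  mu.-integrable setT (EFin \o f) ->
  mu.-integrable setT (EFin \o (fun x => f (- x))).
Proof.
move=> /(@integrable_affine (-1) 0 f); rewrite oppr_eq0 oner_eq0 => /(_ isT).
by rewrite (_ : (fun x => f (-1 * x + 0)) = (fun x => f (- x)))//; apply/funext => x; rewrite mulN1r addr0.
Qed.

Lemma Rintegral_reflect (f : R -> R) :
  mu.-integrable setT (EFin \o f) ->
  \int[mu]_x f (- x) = \int[mu]_x f x.
Proof.
move=> /(@Rintegral_affine (-1) 0 f); rewrite oppr_eq0 oner_eq0 => /(_ isT) ->.
rewrite normrN1 mul1r; apply: eq_Rintegral => x _.
by rewrite mulN1r addr0.
Qed.

Lemma integrable_shift (c : R) (f : R -> R) :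
  mu.-integrable setT (EFin \o f) ->
  mu.-integrable setT (EFin \o (fun x => f (x + c))).
Proof.
move=> /(@integrable_affine 1 c f); rewrite oner_eq0 => /(_ isT).
by rewrite (_ : (fun x => f (1 * x + c)) = (fun x => f (x + c)))//; apply/funext => x; rewrite mul1r.
Qed.

Lemma Rintegral_shift (c : R) (f : R -> R) :
  mu.-integrable setT (EFin \o f) ->
  \int[mu]_x f (x + c) = \int[mu]_x f x.
Proof.
move=> /(@Rintegral_affine 1 c f); rewrite oner_eq0 => /(_ isT) ->.
rewrite normr1 mul1r; apply: eq_Rintegral => x _.
by rewrite mul1r.
Qed.

End affine.

(** * The integral of 1 / (1 + x^2) *)

Section known_integrals.
Context {R : realType}.
Notation mu := (@lebesgue_measure R).

(** The integrand is even, and its integral over the half-line is the limit of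
    the arctangent. *)
Lemma integral_oneDsqr : (\int[mu]_x ((1 + x ^+ 2)^-1)%:E = pi%:E)%E.
Proof.
rewrite ge0_symfun_integralT//=.
- rewrite -set_itvcy.
  have := @integral0y_oneDsqr R; rewrite /oneDsqr => ->.
  by rewrite -EFinM; congr EFin; rewrite mulrC divfK.
- by move=> x; rewrite invr_ge0 addr_ge0// sqr_ge0.
- exact: continuous_oneDsqrV.
- by move=> x /=; rewrite sqrrN.
Qed.

Lemma integrable_oneDsqr : mu.-integrable setT (EFin \o (fun x => (1 + x ^+ 2)^-1)).
Proof.
apply/integrableP; split.
  apply/measurable_EFinP; apply: continuous_measurable_fun; exact: continuous_oneDsqrV.
have -> : (\int[mu]_x `|((1 + x ^+ 2)^-1)%:E| = \int[mu]_x ((1 + x ^+ 2)^-1)%:E)%E.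
  apply: eq_integral => x _; rewrite gee0_abs// lee_fin invr_ge0 addr_ge0//.
  exact: sqr_ge0.
by rewrite integral_oneDsqr ltry.
Qed.

Lemma Rintegral_oneDsqr : \int[mu]_x (1 + x ^+ 2)^-1 = pi.
Proof. by rewrite /Rintegral integral_oneDsqr. Qed.

End known_integrals.

(** * The Lebesgue integral on the line *)

Section lebesgue_line.
Context {R : realType}.
Notation mu := (@lebesgue_measure R).

(** This lemma and the next ones are general facts of integration with the
    measurable structure of the line fixed, which lets unification succeed on
    functions of type R -> R. *)
Lemma lebesgue_dominated_integrable (f g : R -> R) :
  measurable_fun setT f -> (forall x, `|f x| <= g x) ->
  mu.-integrable setT (EFin \o g) -> mu.-integrable setT (EFin \o f).
Proof. exact: (@dominated_integrable _ (measurableTypeR R) R mu). Qed.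

Lemma Rintegrable_measurable (f : R -> R) :
  mu.-integrable setT (EFin \o f) -> measurable_fun setT f.
Proof. by move=> /integrableP[/measurable_EFinP]. Qed.

Lemma RintegrableZl (c : R) (f : R -> R) :
  mu.-integrable setT (EFin \o f) -> mu.-integrable setT (EFin \o (fun x => c * f x)).
Proof. exact: (@integrableZl _ (measurableTypeR R) R mu setT measurableT c). Qed.

Lemma RintegrableD (f g : R -> R) :
  mu.-integrable setT (EFin \o f) -> mu.-integrable setT (EFin \o g) ->
  mu.-integrable setT (EFin \o (fun x => f x + g x)).
Proof. exact: (@integrableD _ (measurableTypeR R) R mu setT measurableT). Qed.

Lemma RintegrableB (f g : R -> R) :
  mu.-integrable setT (EFin \o f) -> mu.-integrable setT (EFin \o g) ->
  mu.-integrable setT (EFin \o (fun x => f x - g x)).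
Proof. exact: (@integrableB _ (measurableTypeR R) R mu setT measurableT). Qed.

Lemma lebesgue_RintegralZl (c : R) (f : R -> R) : mu.-integrable setT (EFin \o f) ->
  \int[mu]_x (c * f x) = c * \int[mu]_x f x.
Proof. exact: (@RintegralZl _ (measurableTypeR R) R mu setT _ _ measurableT). Qed.

Lemma lebesgue_RintegralD (f g : R -> R) :
  mu.-integrable setT (EFin \o f) -> mu.-integrable setT (EFin \o g) ->
  \int[mu]_x (f x + g x) = \int[mu]_x f x + \int[mu]_x g x.
Proof. exact: (@RintegralD _ (measurableTypeR R) R mu setT _ _ measurableT). Qed.

Lemma lebesgue_RintegralB (f g : R -> R) :
  mu.-integrable setT (EFin \o f) -> mu.-integrable setT (EFin \o g) ->
  \int[mu]_x (f x - g x) = \int[mu]_x f x - \int[mu]_x g x.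
Proof. exact: (@RintegralB _ (measurableTypeR R) R mu setT _ _ measurableT). Qed.

Lemma lebesgue_Rintegral_gt0 (f : R -> R) (a b : R) : a < b ->
  mu.-integrable setT (EFin \o f) ->
  (forall x, 0 <= f x) -> (forall x, a < x -> x < b -> 0 < f x) ->
  0 < \int[mu]_x f x.
Proof.
move=> ab iff f0 fab.
apply: (@Rintegral_gt0 _ (measurableTypeR R) R mu f (`]a, b[%classic : set R)
  (measurable_itv _) _ iff f0).
  by rewrite /= lebesgue_measure_itv/= lte_fin ab -EFinB lte_fin subr_gt0.
by move=> x; rewrite /= in_itv/= => /andP[]; exact: fab.
Qed.

Lemma lebesgue_cvg_dominated (f_ : nat -> R -> R) (f g : R -> R) :
  (forall n, measurable_fun setT (f_ n)) -> measurable_fun setT f ->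
  (forall x, f_ n x @[n --> \oo] --> f x) ->
  (forall n x, `|f_ n x| <= g x) -> mu.-integrable setT (EFin \o g) ->
  \int[mu]_x f_ n x @[n --> \oo] --> \int[mu]_x f x.
Proof. exact: (@cvg_dominated_Rintegral _ (measurableTypeR R) R mu). Qed.

Lemma integrable_restrict_itv (i : interval R) (f : R -> \bar R) :
  mu.-integrable [set` i] f -> mu.-integrable setT (f \_ [set` i]).
Proof.
exact: (iffLR (@integrable_mkcond _ (measurableTypeR R) R mu _ f (measurable_itv i))).
Qed.

End lebesgue_line.

(** * Functions vanishing beyond a bound *)

Section compact_support.
Context {R : realType}.
Notation mu := (@lebesgue_measure R).

Definition vanishes_beyond (M : R) (f : R -> R) := forall x, M < `|x| -> f x = 0.

Lemma fsupp_bounded (V : normedModType R) (f : V -> R) :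
  compact (fsupp f) -> exists M : R, 0 <= M /\ forall x, M < `|x| -> f x = 0.
Proof.
move=> /compact_bounded [N [Nreal NM]].
exists (Num.max N 0 + 1); split.
  by rewrite addr_ge0// le_max lexx orbT.
move=> x xM; apply/eqP; apply: contraT => fx0.
have : fsupp f x by apply: subset_closure.
move=> /NM -/(_ (Num.max N 0 + 1)) h.
have : `|x| <= Num.max N 0 + 1.
  by apply: h; rewrite ltr_pwDr// le_max lexx.
by rewrite leNgt xM.
Qed.

Lemma continuous_fsupp_bounded (V : normedModType R) (f : V -> R) :
  continuous f -> compact (fsupp f) -> exists K : R, 0 <= K /\ forall x, `|f x| <= K.
Proof.
move=> cf cpt.
have /compact_bounded [N [Nreal NM]] : compact (f @` (fsupp f)).
  by apply: continuous_compact => //; exact: continuous_subspaceT.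
exists (Num.max N 0 + 1); split.
  by rewrite addr_ge0// le_max lexx orbT.
move=> x; have [->|fx0] := eqVneq (f x) 0.
  by rewrite normr0 addr_ge0// le_max lexx orbT.
apply: (NM (Num.max N 0 + 1)).
  by rewrite ltr_pwDr// le_max lexx.
by exists x => //; apply: subset_closure.
Qed.

Lemma vanishes_beyond_indic (M : R) (f : R -> R) (x K : R) :
  vanishes_beyond M f -> (forall x, `|f x| <= K) ->
  `|f x| <= K * \1_(`[- M, M]%classic : set R) x.
Proof.
move=> sf fK; rewrite indicE; case: (boolP (x \in _)) => [_|].
  by rewrite mulr1.
rewrite notin_setE /= in_itv/= -ler_norml => /negP; rewrite -ltNge => /sf ->.
by rewrite normr0 mulr0.
Qed.

Lemma integrable_vanishes_beyond (M K : R) (f : R -> R) :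
  measurable_fun setT f -> vanishes_beyond M f -> (forall x, `|f x| <= K) ->
  mu.-integrable setT (EFin \o f).
Proof.
move=> mf sf fK.
have ii := integrableZl measurableT K (@integrable_indic_itv R (- M) M true false).
apply: (lebesgue_dominated_integrable mf) ii => x.
exact: vanishes_beyond_indic.
Qed.

Lemma le_Rintegral_vanishes_beyond (M K : R) (f : R -> R) :
  0 <= M -> measurable_fun setT f -> vanishes_beyond M f -> (forall x, `|f x| <= K) ->
  `|\int[mu]_x f x| <= 2 * M * K.
Proof.
move=> M0 mf sf fK.
have iff := integrable_vanishes_beyond mf sf fK.
apply: (le_trans (le_normr_Rintegral measurableT iff)).
have ii := @integrable_indic_itv R (- M) M true false.
apply: (@le_trans _ _ (\int[mu]_x (K * \1_(`[- M, M]%classic : set R) x))).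
  apply: le_Rintegral => //.
  - exact: integrable_norm.
  - exact: (integrableZl measurableT K ii).
  - by move=> x _; exact: vanishes_beyond_indic.
rewrite RintegralZl//.
have -> : \int[mu]_x \1_(`[- M, M]%classic : set R) x = 2 * M.
  rewrite /Rintegral integral_indic// setIT /= lebesgue_measure_itv/= lte_fin.
  case: ltP => [_|]; first by rewrite -EFinD/= opprK mulr_natl mulr2n.
  by move=> h; rewrite /= (_ : M = 0) ?mulr0//; lra.
by rewrite mulrC.
Qed.

(** The fundamental theorem of calculus on an interval that contains the
    support. This is the form in which integration by parts is used below. *)
Lemma Rintegral_derivative_eq0 (M : R) (k k' : R -> R) :
  (forall x : R, is_derive x (1 : R) k (k' x)) -> continuous k' ->
  vanishes_beyond M k -> vanishes_beyond M k' -> \int[mu]_x k' x = 0.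
Proof.
move=> dk ck' sk sk'.
pose N := `|M| + 1.
have MN : M < N by rewrite /N; have := ler_norm M; lra.
have N0 : 0 < N by rewrite /N; have := normr_ge0 M; lra.
have kc : continuous k.
  by move=> x; apply: differentiable_continuous; apply/derivable1_diffP; case: (dk x).
rewrite [LHS](_ : _ = \int[mu]_(x in `[- N, N]%classic) k' x); last first.
  rewrite Rintegral_mkcond [RHS]Rintegral_mkcond; apply: eq_Rintegral => x _.
  rewrite !patchE mem_set//; case: ifPn => //.
  rewrite notin_setE /= in_itv/= -ler_norml => /negP; rewrite -ltNge => Nx.
  by rewrite sk'// (lt_trans MN Nx).
rewrite /Rintegral (@continuous_FTC2 _ k' k)//.
- rewrite !sk ?normrN ?(gtr0_norm N0)//; first by rewrite subee.
- lra.
- exact: continuous_subspaceT.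
- split.
  + by move=> x _; case: (dk x).
  + by apply: cvg_at_right_filter; exact: kc.
  + by apply: cvg_at_left_filter; exact: kc.
- by move=> x _; rewrite derive1E; case: (dk x).
Qed.

End compact_support.

(** * Powers at infinity and at the origin *)

Section power_integrals.
Context {R : realType}.
Notation mu := (@lebesgue_measure R).

Lemma integrable_powR_tail (q : R) : 1 < q ->
  mu.-integrable setT (EFin \o (fun r : R => if 1 < r then r `^ (- q) else 0)).
Proof.
move=> q1.
have -> : (EFin \o (fun r : R => if 1 < r then r `^ (- q) else 0)) =
   ((fun r : R => (r `^ (- q))%:E) \_ `]1, +oo[).
  apply/funext => r /=; rewrite patchE; case: ifPn => r1.
    by rewrite mem_set//= in_itv/= r1.
  by rewrite memNset//= in_itv/= andbT; exact/negP.
apply: integrable_restrict_itv.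
have mp : measurable_fun (`]1, +oo[ : set R) (EFin \o (fun r : R => r `^ (- q))).
  apply/measurable_EFinP; apply: measurable_funTS; exact: measurable_powR.
apply/integrableP; split => //.
have q10 : q - 1 != 0 by rewrite subr_eq0 gt_eqF.
have -> : (\int[mu]_(x in `]1%R, +oo[) `|(x `^ (- q))%:E| =
   \int[mu]_(x in `[1%R, +oo[) (x `^ (- q))%:E)%E.
  rewrite -integral_itv_obnd_cbnd//.
  by apply: eq_integral => x _; rewrite gee0_abs// lee_fin powR_ge0.
have dF (x : R) : 0 < x -> is_derive x 1 (fun r => - (q - 1)^-1 * r `^ (1 - q)) (x `^ (- q)).
  move=> x0; have h := is_derive1_powR (1 - q) x0.
  have := is_deriveZ (- (q - 1)^-1) h.
  rewrite (_ : _ *: _ = x `^ (- q))//.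
  rewrite /GRing.scale/= (_ : 1 - q - 1 = - q); last by ring.
  by field.
have cont (a x : R) : 0 < x -> {for x, continuous (fun r : R => r `^ a)}.
  move=> x0; apply: differentiable_continuous; apply/derivable1_diffP.
  by have [] := is_derive1_powR a x0.
rewrite (@ge0_continuous_FTC2y _ _ (fun r => - (q - 1)^-1 * r `^ (1 - q)) 1 0).
- by rewrite -EFinB ltry.
- by move=> x _; exact: powR_ge0.
- apply/continuous_within_itvcyP; split.
    by move=> x; rewrite in_itv/= andbT => x1; apply: cont; lra.
  by apply: cvg_at_right_filter; apply: cont; lra.
- rewrite -[X in _ --> X](mulr0 (- (q - 1)^-1)); apply: cvgMr.
  have : (fun x : R => (x^-1) `^ (q - 1)) x @[x --> +oo] --> 0.
    apply: (@cvg_comp _ _ _ (fun x : R => x^-1) (fun y => y `^ (q - 1)) _ (0^'+) _).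
      move=> A; rewrite /nbhs/= => -[e e0 Ae].
      exists (e^-1); split; first by rewrite realV gtr0_real.
      move=> x ex /=; have x0 : 0 < x by apply: lt_trans ex; rewrite invr_gt0.
      apply: Ae => /=; last by rewrite invr_gt0.
      rewrite sub0r normrN gtr0_norm ?invr_gt0//.
      by rewrite -[e]invrK ltf_pV2// posrE invr_gt0.
    by apply: powR_cvg0; lra.
  apply: cvg_trans; apply: near_eq_cvg; near=> x.
  have x0 : 0 < x by near: x; exact: nbhs_pinfty_gt.
  by rewrite -powR_inv1 ?ltW// -powRrM; congr (_ `^ _); lra.
- by move=> x x1; have [] := dF x (lt_trans ltr01 x1).
- by apply: cvg_at_right_filter; apply: cvgMr; apply: cont.
- move=> x; rewrite in_itv/= andbT => x1; rewrite derive1E.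
  by apply: derive_val; apply: dF; lra.
Unshelve. all: by end_near. Qed.

Lemma integrable_powR_near0 (p : R) : -1 < p ->
  mu.-integrable setT (EFin \o (fun r : R => if (0 < r) && (r <= 1) then r `^ p else 0)).
Proof.
move=> p1.
have -> : (EFin \o (fun r : R => if (0 < r) && (r <= 1) then r `^ p else 0)) =
   ((fun r : R => (r `^ p)%:E) \_ `]0, 1]).
  apply/funext => r /=; rewrite patchE; case: ifPn => r1.
    by rewrite mem_set//= in_itv/= r1.
  by rewrite memNset//= in_itv/=; exact/negP.
apply: integrable_restrict_itv.
have mp (A : set R) : measurable_fun A (EFin \o (fun r : R => r `^ p)).
  apply/measurable_EFinP; apply: measurable_funTS; exact: measurable_powR.
apply/integrableP; split; first exact: mp.
have p10 : p + 1 != 0 by rewrite gt_eqF//; lra.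
have -> : (\int[mu]_(x in `]0%R, 1%R]) `|(x `^ p)%:E| =
   \int[mu]_(x in `]0%R, 1%R]) (x `^ p)%:E)%E.
  by apply: eq_integral => x _; rewrite gee0_abs// lee_fin powR_ge0.
have dF (x : R) : 0 < x -> is_derive x 1 (fun r => (p + 1)^-1 * r `^ (p + 1)) (x `^ p).
  move=> x0; have h := is_derive1_powR (p + 1) x0.
  have := is_deriveZ ((p + 1)^-1) h.
  rewrite (_ : _ *: _ = x `^ p)//.
  rewrite /GRing.scale/= (_ : p + 1 - 1 = p); last by ring.
  by field.
have cont (a x : R) : 0 < x -> {for x, continuous (fun r : R => r `^ a)}.
  move=> x0; apply: differentiable_continuous; apply/derivable1_diffP.
  by have [] := is_derive1_powR a x0.
(* The integrand is unbounded at 0 if p < 0, so the half-open interval is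
   exhausted by compact ones. *)
pose F (n : nat) : set R := `[n.+2%:R^-1, 1]%classic.
have FE : `]0, 1]%classic = \bigcup_n F n.
  apply/seteqP; split => x /=.
    rewrite in_itv/= => /andP[x0 x1].
    have [n xn] : exists n : nat, x^-1 < n%:R by exists (Num.truncn (x^-1)).+1; exact: truncnS_gt.
    exists n => //; rewrite /F/= in_itv/= x1 andbT.
    rewrite -[x]invrK lef_pV2 ?posrE ?invr_gt0//.
    by rewrite (le_trans (ltW xn))// ler_nat leqW.
  move=> [n _]; rewrite /F/= !in_itv/= => /andP[nx ->]; rewrite andbT.
  by apply: lt_le_trans nx; rewrite invr_gt0.
have ndF : nondecreasing_seq F.
  move=> m n mn; apply/subsetPset => x; rewrite /F/= !in_itv/= => /andP[mx ->].
  rewrite andbT; apply: le_trans mx; by rewrite lef_pV2 ?posrE// ler_nat !ltnS.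
rewrite FE.
have := @ge0_nondecreasing_set_cvg_integral _ (measurableTypeR R) R F (EFin \o (fun r : R => r `^ p)) mu ndF.
move=> /(_ (fun n => measurable_itv _) (fun n => mp _)).
move=> /(_ (fun n x _ => powR_ge0 _ _)) /cvg_lim => /(_ (@ereal_hausdorff R)) <-.
apply: (@le_lt_trans _ _ ((p + 1)^-1)%:E); last exact: ltry.
apply: lime_le.
  apply: ereal_nondecreasing_is_cvgn; apply: ge0_nondecreasing_set_nondecreasing_integral => //.
  - by move=> n; exact: measurable_itv.
  - by move=> n; exact: mp.
  - by move=> n x _; rewrite lee_fin powR_ge0.
apply: nearW => n.
have n0 : 0 < n.+2%:R^-1 :> R by rewrite invr_gt0.
rewrite /F (@continuous_FTC2 _ _ (fun r => (p + 1)^-1 * r `^ (p + 1)))//.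
- rewrite -EFinB lee_fin powR1 mulr1 gerBl mulr_ge0 ?powR_ge0// invr_ge0; lra.
- by rewrite invf_lt1// ltr1n.
- apply: continuous_in_subspaceT => x; rewrite inE/= in_itv/= => /andP[nx _].
  by apply: cont; exact: lt_le_trans n0 nx.
- split.
  + by move=> x; rewrite in_itv/= => /andP[nx _]; have [] := dF x (lt_trans n0 nx).
  + by apply: cvg_at_right_filter; apply: cvgMr; apply: cont.
  + by apply: cvg_at_left_filter; apply: cvgMr; apply: cont; lra.
- move=> x; rewrite in_itv/= => /andP[nx _]; rewrite derive1E.
  by apply: derive_val; apply: dF; exact: lt_trans n0 nx.
Qed.

End power_integrals.

(** * The kernel r^(-1-2s) and the symbol |xi|^(2s) *)

Section stable_constant.
Context {R : realType}.
Notation mu := (@lebesgue_measure R).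
Implicit Types (s r x xi : R).

(** One-sided on purpose: in the singular integral the increments r and -r are
    paired, so that the integral over r > 0 suffices. *)
Definition riesz_kernel s r : R := if 0 < r then r `^ (- (1 + 2 * s)) else 0.

Lemma riesz_kernel_ge0 s r : 0 <= riesz_kernel s r.
Proof. by rewrite /riesz_kernel; case: ifP => // _; exact: powR_ge0. Qed.

Lemma measurable_riesz_kernel s : measurable_fun setT (riesz_kernel s).
Proof.
apply: measurable_fun_ifT => //.
exact: measurable_fun_ltr.
Qed.

Lemma riesz_kernel_scale s a r : 0 < a ->
  riesz_kernel s (a * r) = a `^ (- (1 + 2 * s)) * riesz_kernel s r.
Proof.
move=> a0; rewrite /riesz_kernel pmulr_rgt0//; case: ifPn => r0; last by rewrite mulr0.
by rewrite powRM// ltW.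
Qed.

Lemma riesz_kernel_le s r t : 0 < s -> 0 < t -> t <= r ->
  riesz_kernel s r <= riesz_kernel s t.
Proof.
move=> s0 t0 tr; rewrite /riesz_kernel t0 (lt_le_trans t0 tr) !powRN.
rewrite lef_pV2 ?posrE ?powR_gt0// ?(lt_le_trans t0 tr)//.
by apply: ge0_ler_powR => //; rewrite ?nnegrE; lra.
Qed.

Lemma riesz_kernel_lt s r t : 0 < s -> 0 < t -> t < r ->
  riesz_kernel s r < riesz_kernel s t.
Proof.
move=> s0 t0 tr; rewrite /riesz_kernel t0 (lt_trans t0 tr) !powRN.
rewrite ltf_pV2 ?posrE ?powR_gt0// ?(lt_trans t0 tr)//.
by apply: gt0_ltr_powR => //; rewrite ?nnegrE; lra.
Qed.

Lemma sin_le_id x : 0 <= x -> sin x <= x.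
Proof.
rewrite le_eqVlt => /predU1P[<-|x0]; first by rewrite sin0.
have [|c _ h] := @MVT R sin cos 0 x x0 (fun y _ => is_derive_sin y).
  by apply: continuous_subspaceT => y; exact: continuous_sin.
move: h; rewrite sin0 !subr0 => ->.
by rewrite ler_piMl ?cos_le1// ltW.
Qed.

Lemma one_sub_cos_le x : 1 - cos x <= x ^+ 2.
Proof.
wlog x0 : x / 0 <= x => [h|].
  by have [/h//|x0] := leP 0 x; rewrite -cosN -sqrrN; apply: h; lra.
move: x0; rewrite le_eqVlt => /predU1P[<-|x0].
  by rewrite cos0 expr0n subrr.
have [|c c0x h] := @MVT R cos (fun y => - sin y) 0 x x0 (fun y _ => is_derive_cos y).
  by apply: continuous_subspaceT => y; exact: continuous_cos.
move: h; rewrite cos0 !subr0 => h.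
have -> : 1 - cos x = sin c * x by lra.
move: c0x; rewrite in_itv/= => /andP[c0 cx].
by rewrite expr2 ler_pM2r// (le_trans (sin_le_id (ltW c0)))// ltW.
Qed.

Lemma one_sub_cos_ge0 x : 0 <= 1 - cos x.
Proof. by rewrite subr_ge0 cos_le1. Qed.

(** The constant of the s-stable law, int_0^oo (1 - cos r) r^(-1-2s) dr: it is
    the ratio between the singular integral below and the Fourier multiplier. *)
Definition stable_const s : R := \int[mu]_r ((1 - cos r) * riesz_kernel s r).

Lemma measurable_one_sub_cos_kernel s xi :
  measurable_fun setT (fun r => (1 - cos (r * xi)) * riesz_kernel s r).
Proof.
apply: measurable_funM; last exact: measurable_riesz_kernel.
apply: continuous_measurable_fun => r; apply: cvgB; first exact: cvg_cst.
apply: (@continuous_comp _ _ _ (fun r => r * xi) cos); last exact: continuous_cos.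
by apply: cvgMl; exact: cvg_id.
Qed.

(** Near 0 the bound 1 - cos r <= r^2 leaves the power 1 - 2s > -1; at infinity
    1 - cos r <= 2 leaves the power -1 - 2s < -1. *)
Lemma integrable_stable s : 0 < s -> s < 1 ->
  mu.-integrable setT (EFin \o (fun r => (1 - cos r) * riesz_kernel s r)).
Proof.
move=> s0 s1.
have h1 := @integrable_powR_near0 R (1 - 2 * s) ltac:(lra).
have h2 := RintegrableZl 2 (@integrable_powR_tail R (1 + 2 * s) ltac:(lra)).
have h := RintegrableD h1 h2.
apply: lebesgue_dominated_integrable h => /=.
  have := measurable_one_sub_cos_kernel s 1.
  by under eq_fun do rewrite mulr1.
move=> r; rewrite /= ger0_norm; last first.
  by rewrite mulr_ge0 ?riesz_kernel_ge0 ?one_sub_cos_ge0.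
rewrite /riesz_kernel; case: ifPn => r0; last first.
  have r1 : ~~ (1 < r) by rewrite -leNgt; move: r0; rewrite -leNgt => r0; lra.
  by rewrite (negbTE r1) mulr0 /= mulr0 addr0.
rewrite /=; case: (leP r 1) => r1.
  rewrite mulr0 addr0 (_ : 1 - 2 * s = 2%:R + (- (1 + 2 * s))); last by lra.
  rewrite powRD ?(gt_eqF r0) ?implybT// powR_mulrn ?(ltW r0)//.
  by rewrite ler_wpM2r ?powR_ge0// one_sub_cos_le.
rewrite add0r ler_wpM2r ?powR_ge0//.
by have := cos_geN1 r; lra.
Qed.

Lemma stable_const_gt0 s : 0 < s -> s < 1 -> 0 < stable_const s.
Proof.
move=> s0 s1.
apply: (lebesgue_Rintegral_gt0 ltr01).
- exact: integrable_stable.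
- by move=> r; rewrite mulr_ge0 ?riesz_kernel_ge0 ?one_sub_cos_ge0.
- move=> r r0 r1.
  rewrite mulr_gt0//; last by rewrite /riesz_kernel r0 powR_gt0.
  rewrite subr_gt0 -cos0 ltr_cos// in_itv/= ?lexx ?pi_ge0//.
  by rewrite ltW//=; have := @pi_ge2 R; lra.
Qed.

(** Substituting r := r / |xi| pulls out the homogeneity of the kernel: up to a
    constant, the functions 1 - cos(r xi) superpose to the symbol |xi|^(2s). *)
Lemma stable_const_scale s xi : 0 < s -> s < 1 ->
  mu.-integrable setT (EFin \o (fun r => (1 - cos (r * xi)) * riesz_kernel s r)) /\
  \int[mu]_r ((1 - cos (r * xi)) * riesz_kernel s r) =
    `|xi| `^ (2 * s) * stable_const s.
Proof.
move=> s0 s1; have [->|xi0] := eqVneq xi 0.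
  have -> : (fun r : R => (1 - cos (r * 0)) * riesz_kernel s r) = cst 0.
    by apply/funext => r; rewrite mulr0 cos0 subrr mul0r.
  split; first exact: integrable0.
  rewrite Rintegral_cst// mul0r normr0 powR0 ?mul0r//.
  by rewrite gt_eqF// mulr_gt0.
have a0 : 0 < `|xi| by rewrite normr_gt0.
have a0' : `|xi| != 0 by rewrite gt_eqF.
have ist := integrable_stable s0 s1.
pose g := fun r => (1 - cos r) * riesz_kernel s r.
pose K := `|xi| `^ (1 + 2 * s).
have K0 : K != 0 by rewrite gt_eqF// powR_gt0.
have -> : (fun r : R => (1 - cos (r * xi)) * riesz_kernel s r) =
    (fun r => K * g (`|xi| * r + 0)).
  apply/funext => r; rewrite /g addr0 riesz_kernel_scale// powRN -/K.
  have -> : cos (`|xi| * r) = cos (r * xi).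
    by rewrite -[LHS]cos_norm -[RHS]cos_norm !normrM normr_id mulrC.
  by field.
have ig := integrable_affine 0 a0' ist.
split; first exact: (RintegrableZl K ig).
rewrite (lebesgue_RintegralZl K ig).
rewrite /stable_const (Rintegral_affine 0 a0' ist) normr_id mulrA; congr (_ * _).
rewrite /K powRD; last by rewrite a0' implybT.
by rewrite powRr1 ?ltW// mulrC.
Qed.

End stable_constant.

(** * The Poisson kernel *)

Section poisson.
Context {R : realType}.
Notation mu := (@lebesgue_measure R).
Implicit Types (e z xi : R).

(** On xi >= 0 this is an antiderivative of e^(-e xi) (1 + cos(z xi)). *)
Let G e z xi : R := expR (- (e * xi)) *
  ((z * sin (z * xi) - e * cos (z * xi)) / (e ^+ 2 + z ^+ 2) - e^-1).

(** The integrand contains 1 + cos rather than cos so as to be nonnegative: for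
    such functions the fundamental theorem of calculus on a half-line also
    yields integrability. The cosine alone is recovered by difference. *)
Lemma integral_poisson1 e z : 0 < e ->
  (\int[mu]_xi (expR (- (e * `|xi|)) * (1 + cos (z * xi)))%:E =
   (2 * (e^-1 + e / (e ^+ 2 + z ^+ 2)))%:E)%E.
Proof.
move=> e0.
have D0 : e ^+ 2 + z ^+ 2 != 0.
  by rewrite gt_eqF// ltr_wpDr ?sqr_ge0// exprn_gt0.
have dG xi : is_derive xi (1 : R) (G e z) (expR (- (e * xi)) * (1 + cos (z * xi))).
  rewrite /G.
  apply: is_derive_eq.
  rewrite /GRing.scale/=.
  field.
  by rewrite D0 gt_eqF.
have cG : continuous (G e z).
  move=> xi; apply: differentiable_continuous; apply/derivable1_diffP.
  by case: (dG xi).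
have cf : continuous (fun xi => expR (- (e * xi)) * (1 + cos (z * xi))).
  move=> x; apply: differentiable_continuous; apply/derivable1_diffP.
  by apply: ex_derive.
rewrite ge0_symfun_integralT/=.
- rewrite -set_itvcy.
  have -> : (\int[mu]_(xi in `[0%R, +oo[) (expR (- (e * `|xi|)) * (1 + cos (z * xi)))%:E =
     \int[mu]_(xi in `[0%R, +oo[) (expR (- (e * xi)) * (1 + cos (z * xi)))%:E)%E.
    by apply: eq_integral => xi; rewrite inE/= in_itv/= andbT => xi0; rewrite ger0_norm.
  rewrite (@ge0_continuous_FTC2y _ _ (G e z) 0 0).
  + rewrite /G mulr0 oppr0 expR0 mulr0 sin0 cos0 mulr0 mulr1 mul1r -EFinB -EFinM.
    congr EFin; field.
    by rewrite D0 gt_eqF.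
  + by move=> x _; rewrite mulr_ge0 ?expR_ge0//; have := cos_geN1 (z * x); lra.
  + exact: continuous_subspaceT.
  (* B bounds the factor of the exponential in the antiderivative, which
     therefore tends to 0. *)
  + pose B := (`|z| + e) / (e ^+ 2 + z ^+ 2) + e^-1.
    have E0 : expR (- (e * x)) @[x --> +oo] --> 0.
      apply: (@cvg_comp _ _ _ (fun x => e * x) (fun y => expR (- y)) _ (pinfty_nbhs R)).
        by apply: gt0_cvgMry => //; exact: cvg_id.
      exact: cvgr_expR.
    have hB : B * expR (- (e * x)) @[x --> +oo] --> 0.
      by rewrite -[X in _ --> X](mulr0 B); exact: cvgMr.
    apply: norm_cvg0; apply: (squeeze_cvgr _ (cvg_cst 0) hB).
    apply: nearW => x; rewrite normr_ge0/= /G normrM ger0_norm ?expR_ge0//.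
    rewrite mulrC ler_wpM2r ?expR_ge0// /B (le_trans (ler_normB _ _))//.
    rewrite [`|e^-1|]gtr0_norm ?invr_gt0// lerD2r normrM normfV.
    have D0' : 0 < e ^+ 2 + z ^+ 2 by rewrite ltr_wpDr ?sqr_ge0// exprn_gt0.
    rewrite [`|e ^+ 2 + _|]gtr0_norm// ler_pM2r ?invr_gt0//.
    rewrite (le_trans (ler_normB _ _))// !normrM [`|e|]gtr0_norm//.
    by rewrite lerD// ler_piMr ?sin_max ?cos_max// ltW.
  + by move=> x _; case: (dG x).
  + by apply: cvg_at_right_filter; exact: cG.
  + by move=> x _; rewrite derive1E; case: (dG x).
- by move=> x; rewrite mulr_ge0 ?expR_ge0//; have := cos_geN1 (z * x); lra.
- move=> x; apply: cvgM.
    apply: (@continuous_comp _ _ _ (fun x => - (e * `|x|)) expR); last exact: continuous_expR.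
    by apply: cvgN; apply: cvgMr; exact: norm_continuous.
  apply: cvgD; first exact: cvg_cst.
  apply: (@continuous_comp _ _ _ (fun x => z * x) cos); last exact: continuous_cos.
  by apply: cvgMr; exact: cvg_id.
- by move=> x; rewrite /= normrN mulrN cosN.
Qed.

Let measurable_aux e z :
  measurable_fun setT (fun xi => expR (- (e * `|xi|)) * (1 + cos (z * xi))).
Proof.
apply: measurable_funM.
  apply: measurableT_comp => //; apply: measurable_funN; apply: measurable_funM => //.
apply: measurable_funD => //.
apply: continuous_measurable_fun => x.
apply: (@continuous_comp _ _ _ (fun x => z * x) cos); last exact: continuous_cos.
by apply: cvgMr; exact: cvg_id.
Qed.

Lemma integrable_poisson1 e z : 0 < e ->
  mu.-integrable setT (EFin \o (fun xi => expR (- (e * `|xi|)) * (1 + cos (z * xi)))).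
Proof.
move=> e0; apply/integrableP; split.
  by apply/measurable_EFinP; exact: measurable_aux.
rewrite /comp.
have -> : (\int[mu]_xi `|(expR (- (e * `|xi|)) * (1 + cos (z * xi)))%:E| =
  \int[mu]_xi (expR (- (e * `|xi|)) * (1 + cos (z * xi)))%:E)%E.
  by apply: eq_integral => xi _; rewrite gee0_abs.
by rewrite integral_poisson1// ltry.
Qed.

Lemma integrable_expR_abs e : 0 < e ->
  mu.-integrable setT (EFin \o (fun xi => expR (- (e * `|xi|)))) /\
  \int[mu]_xi expR (- (e * `|xi|)) = 2 / e.
Proof.
move=> e0.
have i0 := integrable_poisson1 0 e0.
have E : (fun xi : R => expR (- (e * `|xi|)) * (1 + cos (0 * xi))) =
   (fun xi => 2 * expR (- (e * `|xi|))).
  by apply/funext => xi; rewrite mul0r cos0 mulrC.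
have i1 : mu.-integrable setT (EFin \o (fun xi => expR (- (e * `|xi|)))).
  have := RintegrableZl 2^-1 i0.
  rewrite (_ : (fun xi : R => _) = (fun xi => expR (- (e * `|xi|))))//.
  by apply/funext => xi; rewrite mul0r cos0; field.
split => //.
have h : \int[mu]_xi (expR (- (e * `|xi|)) * (1 + cos (0 * xi))) = 2 * (2 / e).
  rewrite /Rintegral integral_poisson1//=.
  by rewrite expr0n addr0; field; rewrite gt_eqF.
move: h; rewrite [X in X = _ -> _](_ : _ = \int[mu]_xi (2 * expR (- (e * `|xi|)))).
  by rewrite (lebesgue_RintegralZl 2 i1) => /(mulfI _); apply; rewrite pnatr_eq0.
by apply: eq_Rintegral => xi _; rewrite mul0r cos0 mulrC.
Qed.

Lemma Rintegral_poisson e z : 0 < e ->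
  \int[mu]_xi (expR (- (e * `|xi|)) * cos (z * xi)) = 2 * e / (e ^+ 2 + z ^+ 2).
Proof.
move=> e0.
have i1 := integrable_poisson1 z e0.
have [i2 E2] := integrable_expR_abs e0.
transitivity (\int[mu]_xi (expR (- (e * `|xi|)) * (1 + cos (z * xi)) - expR (- (e * `|xi|)))).
  by apply: eq_Rintegral => xi _; ring.
rewrite (lebesgue_RintegralB i1 i2) E2.
have -> : \int[mu]_xi (expR (- (e * `|xi|)) * (1 + cos (z * xi))) =
  2 * (e^-1 + e / (e ^+ 2 + z ^+ 2)).
  by rewrite /Rintegral integral_poisson1.
have D0 : e ^+ 2 + z ^+ 2 != 0.
  by rewrite gt_eqF// ltr_wpDr ?sqr_ge0// exprn_gt0.
by field; rewrite D0 gt_eqF.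
Qed.

End poisson.

(** * The fractional Laplacian through the cosine transform *)

Section cosine_transform.
Context {R : realType}.
Notation mu := (@lebesgue_measure R).
Implicit Types (f : R -> R) (s x xi M K : R).

(** The real part of e^(i x xi) times the Fourier transform of f at xi. *)
Definition cosT f x xi : R := \int[mu]_y (f y * cos ((x - y) * xi)).

Lemma continuous_vanishes_bounded f M : continuous f -> vanishes_beyond M f ->
  exists K, forall x, `|f x| <= K.
Proof.
move=> cf sf.
have : compact (fsupp f).
  apply: (@subclosed_compact _ _ (`[- M, M]%classic : set R)).
  - exact: closed_closure.
  - exact: segment_compact.
  - have -> : `[- M, M]%classic = closure (`[- M, M]%classic : set R).
      by apply/closure_id; exact: itv_closed.
    apply: closure_subset => x /=; rewrite in_itv/= -ler_norml => fx0.
    by rewrite leNgt; apply: contra fx0 => /sf ->.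
by move=> /(continuous_fsupp_bounded cf)[K [_ fK]]; exists K.
Qed.

Lemma integrable_continuous_vanishes f M : continuous f -> vanishes_beyond M f ->
  mu.-integrable setT (EFin \o f).
Proof.
move=> cf sf; have [K fK] := continuous_vanishes_bounded cf sf.
exact: integrable_vanishes_beyond (continuous_measurable_fun cf) sf fK.
Qed.

Lemma continuous_cos_affine x xi : continuous (fun y : R => cos ((x - y) * xi)).
Proof.
move=> y; apply: (@continuous_comp _ _ _ (fun y => (x - y) * xi) cos); last exact: continuous_cos.
by apply: cvgMl; apply: cvgB; [exact: cvg_cst|exact: cvg_id].
Qed.

Lemma integrableM_bounded f (g : R -> R) (C : R) : mu.-integrable setT (EFin \o f) ->
  measurable_fun setT g -> (forall x, `|g x| <= C) ->
  mu.-integrable setT (EFin \o (fun x => f x * g x)).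
Proof.
move=> iff mg gC.
have h := RintegrableZl C (integrable_norm iff).
apply: lebesgue_dominated_integrable h.
  by apply: measurable_funM => //; exact: Rintegrable_measurable.
move=> x /=; rewrite normrM mulrC ler_wpM2r//.
Qed.

Lemma integrable_cosT f x xi : mu.-integrable setT (EFin \o f) ->
  mu.-integrable setT (EFin \o (fun y => f y * cos ((x - y) * xi))).
Proof.
move=> iff; apply: (integrableM_bounded (C := 1)) => //.
  by apply: continuous_measurable_fun; exact: continuous_cos_affine.
by move=> y; exact: cos_max.
Qed.

Lemma measurable_cosT f x : measurable_fun setT f -> measurable_fun setT (cosT f x).
Proof.
move=> mf.
apply: (@measurable_Rintegral_param _ _ (measurableTypeR R) (measurableTypeR R) R mu
  (fun p => f p.2 * cos ((x - p.2) * p.1))).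
apply: measurable_funM.
  by apply: (measurableT_comp (f := f)) => //; exact: measurable_snd.
apply: (measurableT_comp (f := cos)).
  exact: continuous_measurable_fun (@continuous_cos R).
apply: measurable_funM; last exact: measurable_fst.
by apply: measurable_funB => //; exact: measurable_snd.
Qed.

Lemma integrable_cos_lin f xi : mu.-integrable setT (EFin \o f) ->
  mu.-integrable setT (EFin \o (fun y => f y * cos (y * xi))).
Proof.
move=> iff; apply: (integrableM_bounded (C := 1)) => //; last by move=> y; exact: cos_max.
have h : continuous (fun y : R => cos (y * xi)).
  move=> y; apply: (@continuous_comp _ _ _ (fun y : R => y * xi) cos); last exact: continuous_cos.
  by apply: cvgMl; exact: cvg_id.
exact: continuous_measurable_fun h.
Qed.

Lemma integrable_sin_lin f xi : mu.-integrable setT (EFin \o f) ->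
  mu.-integrable setT (EFin \o (fun y => f y * sin (y * xi))).
Proof.
move=> iff; apply: (integrableM_bounded (C := 1)) => //; last by move=> y; exact: sin_max.
have h : continuous (fun y : R => sin (y * xi)).
  move=> y; apply: (@continuous_comp _ _ _ (fun y : R => y * xi) sin); last exact: continuous_sin.
  by apply: cvgMl; exact: cvg_id.
exact: continuous_measurable_fun h.
Qed.

(** In the definition of the fractional Laplacian, the addition formula of the
    cosine gathers the real and imaginary parts of the Fourier transform. *)
Lemma fraclapE s f x : mu.-integrable setT (EFin \o f) ->
  fraclap s f x = (2 * pi)^-1 * \int[mu]_xi (`|xi| `^ (2 * s) * cosT f x xi).
Proof.
move=> iff; rewrite /fraclap /cintegral /=.
rewrite mul0r subr0; congr (_ * _); apply: eq_Rintegral => xi _.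
rewrite /fourier /cintegral /=.
have i1 := integrable_cos_lin xi iff.
have i2 := integrable_sin_lin xi iff.
have -> : \int[mu]_y (f y * cos (- (y * xi)) - 0 * sin (- (y * xi))) =
    \int[mu]_y (f y * cos (y * xi)).
  by apply: eq_Rintegral => y _; rewrite mul0r subr0 cosN.
have -> : \int[mu]_y (f y * sin (- (y * xi)) + 0 * cos (- (y * xi))) =
    - 1 * \int[mu]_y (f y * sin (y * xi)).
  rewrite -lebesgue_RintegralZl//.
  by apply: eq_Rintegral => y _; rewrite mul0r addr0 sinN mulrN mulN1r.
have -> : cosT f x xi = cos (x * xi) * \int[mu]_y (f y * cos (y * xi)) +
    sin (x * xi) * \int[mu]_y (f y * sin (y * xi)).
  rewrite -!lebesgue_RintegralZl// -lebesgue_RintegralD; [|exact: RintegrableZl..].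
  apply: eq_Rintegral => y _.
  by rewrite mulrBl cosB; ring.
ring.
Qed.

(** The fractional Laplacian is an iterated parameter integral in the cosine
    form, so it is jointly measurable in the point and in a parameter v on which
    the function depends measurably. *)
Lemma measurable_fraclap_family {d} {T : measurableType d} s
    (F : T * measurableTypeR R -> R) :
  measurable_fun setT F ->
  (forall v, mu.-integrable setT (EFin \o (fun y => F (v, y)))) ->
  measurable_fun setT
    (fun p : T * measurableTypeR R => fraclap s (fun y => F (p.1, y)) p.2).
Proof.
move=> mF iF.
have -> : (fun p : T * measurableTypeR R => fraclap s (fun y => F (p.1, y)) p.2) =
  (fun p => (2 * pi)^-1 *
     \int[mu]_xi (`|xi| `^ (2 * s) * cosT (fun y => F (p.1, y)) p.2 xi)).
  by apply/funext => p; exact: fraclapE.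
apply: measurable_funM => //.
apply: (@measurable_Rintegral_param _ _ _ (measurableTypeR R) R mu
  (fun q : (T * measurableTypeR R) * measurableTypeR R =>
    `|q.2| `^ (2 * s) * cosT (fun y => F (q.1.1, y)) q.1.2 q.2)).
apply: measurable_funM.
  apply: (measurableT_comp (f := fun r : R => `|r| `^ (2 * s))); last exact: measurable_snd.
  exact: (measurableT_comp (f := (@powR R)^~ (2 * s))).
pose T4 : measurableType _ := (((T * measurableTypeR R) * measurableTypeR R) * measurableTypeR R)%type.
apply: (@measurable_Rintegral_param _ _ _ (measurableTypeR R) R mu
  (fun q : T4 => F (q.1.1.1, q.2) * cos ((q.1.1.2 - q.2) * q.1.2))).
have m11 : measurable_fun setT (fun q : T4 => q.1.1).
  by apply: (measurableT_comp (f := fst)); exact: measurable_fst.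
have m111 : measurable_fun setT (fun q : T4 => q.1.1.1).
  by apply: (measurableT_comp (f := fst)) => //; exact: measurable_fst.
have m112 : measurable_fun setT (fun q : T4 => q.1.1.2).
  by apply: (measurableT_comp (f := snd)) => //; exact: measurable_snd.
have m12 : measurable_fun setT (fun q : T4 => q.1.2).
  by apply: (measurableT_comp (f := snd)); [exact: measurable_snd|exact: measurable_fst].
have m2 : measurable_fun setT (fun q : T4 => q.2) by exact: measurable_snd.
apply: measurable_funM.
  by apply: (measurableT_comp (f := F)) => //; exact: measurable_fun_pair.
apply: (measurableT_comp (f := cos)).
  exact: continuous_measurable_fun (@continuous_cos R).
by apply: measurable_funM => //; exact: measurable_funB.
Qed.

Lemma measurable_fraclap s f : mu.-integrable setT (EFin \o f) ->
  measurable_fun setT (fraclap s f).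
Proof.
move=> iff.
have mF : measurable_fun setT (fun q : measurableTypeR R * measurableTypeR R => f q.2).
  by apply: (measurableT_comp (Rintegrable_measurable iff)); exact: measurable_snd.
have h := measurable_fraclap_family s mF (fun=> iff).
(* A single function is the section at v = 0 of the family that does not depend
   on v. *)
exact: (measurable_fun_pair2 (0 : measurableTypeR R) h).
Qed.

(** Two integrations by parts. *)
Lemma cosT_deriv2 f f1 f2 M x xi :
  (forall y : R, is_derive y (1 : R) f (f1 y)) ->
  (forall y : R, is_derive y (1 : R) f1 (f2 y)) -> continuous f2 ->
  vanishes_beyond M f -> vanishes_beyond M f1 -> vanishes_beyond M f2 ->
  xi ^+ 2 * cosT f x xi = - cosT f2 x xi.
Proof.
move=> d1 d2 c2 s0 s1 s2.
have c0 : continuous f.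
  by move=> y; apply: differentiable_continuous; apply/derivable1_diffP; case: (d1 y).
have i0 := integrable_cosT x xi (integrable_continuous_vanishes c0 s0).
have i2 := integrable_cosT x xi (integrable_continuous_vanishes c2 s2).
(* The boundary term of the two integrations by parts; its derivative is the sum
   of the two integrands to be compared. *)
pose k y := f1 y * cos ((x - y) * xi) - xi * (f y * sin ((x - y) * xi)).
pose k' y := f2 y * cos ((x - y) * xi) + xi ^+ 2 * (f y * cos ((x - y) * xi)).
have : \int[mu]_y k' y = 0.
  apply: (@Rintegral_derivative_eq0 R M k k').
  - move=> y; rewrite /k /k'.
    have da : is_derive y (1 : R) (fun y => (x - y) * xi) (- xi).
      by apply: is_derive_eq; rewrite /GRing.scale/=; ring.
    have dc := @is_derive1_comp R cos (fun y => (x - y) * xi) y _ _ (is_derive_cos _) da.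
    have ds := @is_derive1_comp R sin (fun y => (x - y) * xi) y _ _ (is_derive_sin _) da.
    have e1 := is_deriveM (d2 y) dc.
    have e2 := is_deriveZ xi (is_deriveM (d1 y) ds).
    have e3 := is_deriveB e1 e2.
    apply: is_derive_eq; rewrite /GRing.scale/=; ring.
  - move=> y; apply: cvgD; first by apply: cvgM; [exact: c2|exact: continuous_cos_affine].
    by apply: cvgMr; apply: cvgM; [exact: c0|exact: continuous_cos_affine].
  - by move=> y My; rewrite /k s1// s0// !mul0r mulr0 subrr.
  - by move=> y My; rewrite /k' s2// s0// !mul0r mulr0 addr0.
rewrite /k' lebesgue_RintegralD//; last exact: RintegrableZl.
rewrite lebesgue_RintegralZl// -/(cosT f x xi) -/(cosT f2 x xi) => h; lra.
Qed.

Lemma cosT_le f M K x xi : 0 <= M -> continuous f -> vanishes_beyond M f ->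
  (forall y, `|f y| <= K) -> `|cosT f x xi| <= 2 * M * K.
Proof.
move=> M0 cf sf fK; apply: le_Rintegral_vanishes_beyond => //.
- apply: measurable_funM; first exact: continuous_measurable_fun.
  by apply: continuous_measurable_fun; exact: continuous_cos_affine.
- by move=> y My; rewrite sf// mul0r.
- move=> y; rewrite normrM (le_trans _ (fK y))// ler_piMr//.
  exact: cos_max.
Qed.

(** Four derivatives make the cosine transform decay like (1 + xi^2)^-2, so that
    it stays integrable after multiplication by |xi|^(2s) <= 1 + xi^2. The
    bounds M and K are carried along because all estimates have to be uniform
    over the time slices of a test function. *)
Record C4_supported M K f : Prop := C4Supported {
  C4_derivs : exists f1 f2 f3 f4 : R -> R,
    [/\ forall y : R, is_derive y (1 : R) f (f1 y),
        forall y : R, is_derive y (1 : R) f1 (f2 y),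
        forall y : R, is_derive y (1 : R) f2 (f3 y),
        forall y : R, is_derive y (1 : R) f3 (f4 y) &
      [/\ vanishes_beyond M f1, vanishes_beyond M f2, vanishes_beyond M f3,
          vanishes_beyond M f4 & continuous f4 /\ forall y, `|f4 y| <= K]];
  C4_supp : vanishes_beyond M f;
  C4_bound : forall y, `|f y| <= K }.

Lemma C4_continuous M K f : C4_supported M K f -> continuous f.
Proof.
move=> [[f1 [f2 [f3 [f4 [d1 _ _ _ _]]]]] _ _] y.
by apply: differentiable_continuous; apply/derivable1_diffP; case: (d1 y).
Qed.

Lemma C4_integrable M K f : C4_supported M K f -> mu.-integrable setT (EFin \o f).
Proof.
move=> Hf; apply: integrable_continuous_vanishes (C4_supp Hf).
exact: C4_continuous Hf.
Qed.

(** Applying two integrations by parts twice bounds xi^4 times the transform by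
    the transform of the fourth derivative. *)
Lemma cosT_decay M K f x xi : 0 <= M -> C4_supported M K f ->
  `|cosT f x xi| * (1 + xi ^+ 2) ^+ 2 <= 8 * M * K.
Proof.
move=> M0 Hf; have cf := C4_continuous Hf.
case: Hf => -[f1 [f2 [f3 [f4 [d1 d2 d3 d4 [s1 s2 s3 s4 [c4 b4]]]]]]] s0 b0.
have h0 := cosT_le x xi M0 cf s0 b0.
have h4 := cosT_le x xi M0 c4 s4 b4.
have c2 : continuous f2.
  by move=> y; apply: differentiable_continuous; apply/derivable1_diffP; case: (d3 y).
have e1 := cosT_deriv2 x xi d1 d2 c2 s0 s1 s2.
have e2 := cosT_deriv2 x xi d3 d4 c4 s2 s3 s4.
have e3 : xi ^+ 4 * cosT f x xi = cosT f4 x xi.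
  rewrite (_ : xi ^+ 4 = xi ^+ 2 * xi ^+ 2); last by ring.
  by rewrite -mulrA e1 mulrN e2 opprK.
have h4' : xi ^+ 4 * `|cosT f x xi| <= 2 * M * K.
  have -> : xi ^+ 4 = `|xi ^+ 4| by rewrite ger0_norm// exprn_even_ge0.
  by rewrite -normrM e3.
(* (1 + xi^2)^2 <= 2 (1 + xi^4), and both 1 and xi^4 times the transform are at
   most 2 M K. *)
apply: (@le_trans _ _ (`|cosT f x xi| * (2 * (1 + xi ^+ 4)))).
  apply: ler_wpM2l => //.
  have -> : 2 * (1 + xi ^+ 4) = (1 + xi ^+ 2) ^+ 2 + (1 - xi ^+ 2) ^+ 2 by ring.
  by rewrite lerDl sqr_ge0.
lra.
Qed.

Lemma powR_abs_le s xi : 0 < s -> s < 1 -> `|xi| `^ (2 * s) <= 1 + xi ^+ 2.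
Proof.
move=> s0 s1; have [xi1|xi1] := leP `|xi| 1.
  rewrite (@le_trans _ _ 1)// ?lerDl ?sqr_ge0//.
  apply: (@le_trans _ _ (1 `^ (2 * s))); last by rewrite powR1.
  apply: ge0_ler_powR => //; rewrite ?nnegrE//; lra.
rewrite (@le_trans _ _ (`|xi| `^ 2%:R))//.
  by apply: ler_powR; [exact: ltW|lra].
by rewrite powR_mulrn// real_normK ?num_real// lerDr.
Qed.

Lemma symbol_cosT_le M K f s x xi : 0 <= M -> C4_supported M K f -> 0 < s -> s < 1 ->
  `|xi| `^ (2 * s) * `|cosT f x xi| <= 8 * M * K * (1 + xi ^+ 2)^-1.
Proof.
move=> M0 Hf s0 s1.
have D : 0 < 1 + xi ^+ 2 by rewrite ltr_pwDl// sqr_ge0.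
rewrite ler_pdivlMr//.
apply: le_trans (cosT_decay x xi M0 Hf).
rewrite expr2 mulrA ler_wpM2r ?(ltW D)//.
by rewrite mulrC ler_wpM2l// powR_abs_le.
Qed.

Lemma cosT_le_oneDsqr M K f x xi : 0 <= M -> C4_supported M K f ->
  `|cosT f x xi| <= 8 * M * K * (1 + xi ^+ 2)^-1.
Proof.
move=> M0 Hf.
have D : 0 < 1 + xi ^+ 2 by rewrite ltr_pwDl// sqr_ge0.
rewrite ler_pdivlMr//.
apply: le_trans (cosT_decay x xi M0 Hf).
apply: ler_wpM2l => //.
rewrite expr2 ler_peMl ?(ltW D)// lerDl sqr_ge0//.
Qed.

Lemma measurable_symbol_cosT f s x : measurable_fun setT f ->
  measurable_fun setT (fun xi => `|xi| `^ (2 * s) * cosT f x xi).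
Proof.
move=> mf; apply: measurable_funM; last exact: measurable_cosT.
exact: (measurableT_comp (f := (@powR R)^~ (2 * s))).
Qed.

Lemma integrable_symbol_cosT M K f s x : 0 <= M -> C4_supported M K f -> 0 < s -> s < 1 ->
  mu.-integrable setT (EFin \o (fun xi => `|xi| `^ (2 * s) * cosT f x xi)).
Proof.
move=> M0 Hf s0 s1.
have h := RintegrableZl (8 * M * K) (@integrable_oneDsqr R).
apply: lebesgue_dominated_integrable h.
  exact: measurable_symbol_cosT (continuous_measurable_fun (C4_continuous Hf)).
move=> xi; rewrite normrM ger0_norm ?powR_ge0//.
exact: symbol_cosT_le.
Qed.

Lemma integrable_cosT_freq M K f x : 0 <= M -> C4_supported M K f ->
  mu.-integrable setT (EFin \o (cosT f x)).
Proof.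
move=> M0 Hf.
have h := RintegrableZl (8 * M * K) (@integrable_oneDsqr R).
apply: lebesgue_dominated_integrable h.
  exact: measurable_cosT (continuous_measurable_fun (C4_continuous Hf)).
by move=> xi; exact: cosT_le_oneDsqr.
Qed.

Lemma fraclap_le M K f s x : 0 <= M -> C4_supported M K f -> 0 < s -> s < 1 ->
  `|fraclap s f x| <= 4 * M * K.
Proof.
move=> M0 Hf s0 s1; rewrite fraclapE; last exact: C4_integrable Hf.
have isc := integrable_symbol_cosT x M0 Hf s0 s1.
have p0 := @pi_gt0 R.
rewrite normrM gtr0_norm ?invr_gt0 ?mulr_gt0// ler_pdivrMl ?mulr_gt0//.
apply: (le_trans (le_normr_Rintegral measurableT isc)).
have h := RintegrableZl (8 * M * K) (@integrable_oneDsqr R).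
apply: (@le_trans _ _ (\int[mu]_xi (8 * M * K * (1 + xi ^+ 2)^-1))).
  apply: le_Rintegral => //; first exact: (integrable_norm isc).
  by move=> xi _; rewrite normrM ger0_norm ?powR_ge0// symbol_cosT_le.
rewrite lebesgue_RintegralZl; last exact: integrable_oneDsqr.
by rewrite Rintegral_oneDsqr; lra.
Qed.

End cosine_transform.

(** * Inversion and the singular integral *)

Section inversion.
Context {R : realType}.
Notation mu := (@lebesgue_measure R).
Implicit Types (f : R -> R) (s x xi M K : R).

Let eps (n : nat) : R := n.+1%:R^-1.

Let eps_gt0 n : 0 < eps n. Proof. by rewrite invr_gt0. Qed.

Let eps_cvg0 : eps n @[n --> \oo] --> 0.
Proof. exact: cvg_harmonic. Qed.

(** Exchanging the integrals turns the Abel mean of the cosine transform into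
    the convolution of f with the Poisson kernel; the substitution y = x - e u
    then isolates the dependence on e. *)
Lemma cosT_abel (e : R) f x : 0 < e -> mu.-integrable setT (EFin \o f) ->
  \int[mu]_xi (expR (- (e * `|xi|)) * cosT f x xi) =
  2 * \int[mu]_u (f (- e * u + x) * (1 + u ^+ 2)^-1).
Proof.
move=> e0 iff.
have [iE _] := integrable_expR_abs e0.
have mf := Rintegrable_measurable iff.
pose F (p : R * R) := expR (- (e * `|p.1|)) * (f p.2 * cos ((x - p.2) * p.1)).
have iF : (mu \x mu)%E.-integrable setT (EFin \o F).
  have h := integrable_prodM iE (integrable_norm iff).
  apply: (dominated_integrable _ _ h).
    apply: measurable_funM.
      exact: (measurableT_comp (Rintegrable_measurable iE) measurable_fst).
    apply: measurable_funM.
      by apply: (measurableT_comp (f := f)) => //; exact: measurable_snd.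
    apply: (measurableT_comp (f := cos)).
      exact: continuous_measurable_fun (@continuous_cos R).
    apply: measurable_funM; last exact: measurable_fst.
    by apply: measurable_funB => //; exact: measurable_snd.
  move=> p; rewrite /F normrM ger0_norm ?expR_ge0// ler_wpM2l ?expR_ge0//.
  by rewrite /= normrM ler_piMr// cos_max.
transitivity (\int[mu]_xi \int[mu]_y (expR (- (e * `|xi|)) * (f y * cos ((x - y) * xi)))).
  apply: eq_Rintegral => xi _; apply/esym/lebesgue_RintegralZl.
  exact: integrable_cosT.
rewrite (Rintegral_exchange iF) /F /=.
clear iF F.
have Dy y : 0 < e ^+ 2 + (x - y) ^+ 2 by rewrite ltr_wpDr ?sqr_ge0// exprn_gt0.
transitivity (\int[mu]_y (f y * (2 * e / (e ^+ 2 + (x - y) ^+ 2)))).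
  apply: eq_Rintegral => y _.
  rewrite -Rintegral_poisson// -lebesgue_RintegralZl.
    by apply: eq_Rintegral => xi _; ring.
  apply: (integrableM_bounded (C := 1)) => //; last by move=> ?; exact: cos_max.
  have hc : continuous (fun xi : R => cos ((x - y) * xi)).
    move=> z; apply: (@continuous_comp _ _ _ (fun z : R => (x - y) * z) cos); last exact: continuous_cos.
    by apply: cvgMr; exact: cvg_id.
  exact: continuous_measurable_fun hc.
have ih : mu.-integrable setT (EFin \o (fun y => f y * (2 * e / (e ^+ 2 + (x - y) ^+ 2)))).
  apply: (integrableM_bounded (C := 2 / e)) => //.
    have hc : continuous (fun y : R => 2 * e / (e ^+ 2 + (x - y) ^+ 2)).
      move=> y; apply: cvgMr; apply: cvgV; first by rewrite gt_eqF.
      apply: cvgD; first exact: cvg_cst.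
      apply: (@continuous_comp _ _ _ (fun y : R => x - y) (fun y : R => y ^+ 2)).
        by apply: cvgB; [exact: cvg_cst|exact: cvg_id].
      exact: exprn_continuous.
    exact: continuous_measurable_fun hc.
  move=> y; rewrite ger0_norm; last first.
    by rewrite divr_ge0 ?mulr_ge0// ltW.
  rewrite ler_pdivrMr// (_ : 2 / e * _ = 2 * e + 2 / e * (x - y) ^+ 2).
    by rewrite lerDl mulr_ge0 ?sqr_ge0// divr_ge0// ltW.
  by field; rewrite gt_eqF.
have eN0 : - e != 0 by rewrite oppr_eq0 gt_eqF.
rewrite (Rintegral_affine x eN0 ih) normrN gtr0_norm//.
have ih' := integrable_affine x eN0 ih.
rewrite -lebesgue_RintegralZl//.
transitivity (\int[mu]_u (2 * (f (- e * u + x) * (1 + u ^+ 2)^-1))).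
  apply: eq_Rintegral => u _.
  have D1 : 1 + u ^+ 2 != 0 by rewrite gt_eqF// ltr_pwDl// sqr_ge0.
  have -> : e ^+ 2 + (x - (- e * u + x)) ^+ 2 = e ^+ 2 * (1 + u ^+ 2) by ring.
  by field; rewrite D1 (gt_eqF e0).
apply: lebesgue_RintegralZl.
have := RintegrableZl (e / 2) ih'.
rewrite (_ : (fun _ => _) = (fun u => f (- e * u + x) * (1 + u ^+ 2)^-1))//.
apply/funext => u.
have D1 : 1 + u ^+ 2 != 0 by rewrite gt_eqF// ltr_pwDl// sqr_ge0.
have -> : e ^+ 2 + (x - (- e * u + x)) ^+ 2 = e ^+ 2 * (1 + u ^+ 2) by ring.
by field; rewrite D1 (gt_eqF e0).
Qed.

(** Fourier inversion: let e = 1/(n+1) tend to 0 on both sides of the Abel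
    identity; dominated convergence applies on the left by the decay of the
    transform, and on the right by the boundedness of f. *)
Lemma cosT_inversion M K f x : 0 <= M -> C4_supported M K f ->
  \int[mu]_xi cosT f x xi = 2 * pi * f x.
Proof.
move=> M0 Hf.
have cf := C4_continuous Hf; have iff := C4_integrable Hf.
have mf := continuous_measurable_fun cf.
have iA := integrable_cosT_freq x M0 Hf.
have lim1 : \int[mu]_xi (expR (- (eps n * `|xi|)) * cosT f x xi) @[n --> \oo] -->
    \int[mu]_xi cosT f x xi.
  apply: (lebesgue_cvg_dominated (g := fun xi => `|cosT f x xi|)).
  - move=> n; apply: measurable_funM; last exact: Rintegrable_measurable iA.
    exact: Rintegrable_measurable (integrable_expR_abs (eps_gt0 n)).1.
  - exact: Rintegrable_measurable iA.
  - move=> xi; rewrite -[X in _ --> X]mul1r; apply: cvgMl.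
    have : - (eps n * `|xi|) @[n --> \oo] --> 0.
      by rewrite -[X in _ --> X]oppr0 -(mul0r `|xi|); apply: cvgN; apply: cvgMl; exact: eps_cvg0.
    move=> h; rewrite -expR0; apply: (@cvg_comp _ _ _ _ expR _ _ _ h).
    exact: continuous_expR.
  - move=> n xi; rewrite normrM ger0_norm ?expR_ge0// ler_piMl//.
    by rewrite -expR0 ler_expR oppr_le0 mulr_ge0// ltW.
  - exact: (integrable_norm iA).
have lim2 : 2 * \int[mu]_u (f (- eps n * u + x) * (1 + u ^+ 2)^-1) @[n --> \oo] -->
    2 * \int[mu]_u (f x * (1 + u ^+ 2)^-1).
  apply: cvgMr.
  apply: (lebesgue_cvg_dominated (g := fun u => K * (1 + u ^+ 2)^-1)).
  - move=> n; apply: measurable_funM; last exact: Rintegrable_measurable integrable_oneDsqr.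
    by apply: (measurableT_comp (f := f)) => //; exact: measurable_affine.
  - by apply: measurable_funM => //; exact: Rintegrable_measurable integrable_oneDsqr.
  - move=> u; apply: cvgMl.
    have : - eps n * u + x @[n --> \oo] --> x.
      rewrite -[X in _ --> X]add0r; apply: cvgD; last exact: cvg_cst.
      by rewrite -(mul0r u); apply: cvgMl; rewrite -oppr0; apply: cvgN; exact: eps_cvg0.
    exact: (continuous_cvg _ (cf x)).
  - move=> n u; rewrite normrM [X in _ * X]ger0_norm; last first.
      by rewrite invr_ge0 addr_ge0// sqr_ge0.
    rewrite ler_wpM2r ?(C4_bound Hf)// invr_ge0 addr_ge0// sqr_ge0//.
  - exact: (RintegrableZl K (@integrable_oneDsqr R)).
have E : (fun n => \int[mu]_xi (expR (- (eps n * `|xi|)) * cosT f x xi)) =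
  (fun n => 2 * \int[mu]_u (f (- eps n * u + x) * (1 + u ^+ 2)^-1)).
  by apply/funext => n; exact: cosT_abel.
rewrite E in lim1.
have := cvg_unique _ lim1 lim2 => ->//.
rewrite (lebesgue_RintegralZl _ (@integrable_oneDsqr R)) Rintegral_oneDsqr; ring.
Qed.

(** On the transform side, f minus the mean of its translates by r and -r is
    multiplication by 1 - cos(r xi). *)
Lemma cosT_shift_average f x r xi : mu.-integrable setT (EFin \o f) ->
  cosT f x xi * (1 - cos (r * xi)) =
  cosT f x xi - 2^-1 * (cosT f (x + r) xi + cosT f (x - r) xi).
Proof.
move=> iff; rewrite mulrBr mulr1; congr (_ - _).
rewrite /cosT -lebesgue_RintegralD; [|exact: integrable_cosT..].
rewrite -lebesgue_RintegralZl; last by apply: RintegrableD; exact: integrable_cosT.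
rewrite mulrC -lebesgue_RintegralZl; last exact: integrable_cosT.
apply: eq_Rintegral => y _.
rewrite (_ : (x + r - y) * xi = (x - y) * xi + r * xi); last by ring.
rewrite (_ : (x - r - y) * xi = (x - y) * xi - r * xi); last by ring.
by rewrite cosD cosB; field.
Qed.

(** Replace the symbol |xi|^(2s) by its expression as an integral in r, exchange
    the two integrals, and invert the transform for each r. *)
Lemma fraclap_singular_integral M K f s x : 0 <= M -> C4_supported M K f ->
  0 < s -> s < 1 ->
  stable_const s * fraclap s f x =
  \int[mu]_r (riesz_kernel s r * (f x - 2^-1 * (f (x + r) + f (x - r)))).
Proof.
move=> M0 Hf s0 s1.
have iff := C4_integrable Hf.
have iA x' := integrable_cosT_freq x' M0 Hf.
have mA := Rintegrable_measurable (iA x).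
pose F (p : R * R) := cosT f x p.1 * ((1 - cos (p.2 * p.1)) * riesz_kernel s p.2).
have mF : measurable_fun setT F.
  apply: measurable_funM.
    by apply: (measurableT_comp (f := cosT f x)) => //; exact: measurable_fst.
  apply: measurable_funM.
    apply: measurable_funB => //.
    apply: (measurableT_comp (f := cos)).
      exact: continuous_measurable_fun (@continuous_cos R).
    by apply: measurable_funM; [exact: measurable_snd|exact: measurable_fst].
  apply: (measurableT_comp (f := riesz_kernel s)); first exact: measurable_riesz_kernel.
  exact: measurable_snd.
have isc := integrable_symbol_cosT x M0 Hf s0 s1.
have iF : (mu \x mu)%E.-integrable setT (EFin \o F).
  apply/integrable12ltyP; first exact/measurable_EFinP.
  (* By Tonelli: at fixed xi, the absolute value integrates in r to stable_const
     s |xi|^(2s) |cosT f x xi|. *)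
  have [_] := integrableP _ _ _ (RintegrableZl (stable_const s) isc).
  congr (_ < _)%E; apply: eq_integral => xi _ /=.
  rewrite [RHS](_ : _ = \int[mu]_r ((`|cosT f x xi|)%:E * ((1 - cos (r * xi)) * riesz_kernel s r)%:E))%E; last first.
    apply: eq_integral => r _; rewrite /F /= -EFinM normrM [X in _ * X]ger0_norm//.
    by rewrite mulr_ge0 ?riesz_kernel_ge0 ?one_sub_cos_ge0.
  have [i1 E1] := stable_const_scale xi s0 s1.
  rewrite (integralZl measurableT i1).
  rewrite -[X in (_ * X)%E]fineK; last exact: (integrable_fin_num measurableT i1).
  rewrite -[fine _]/(\int[mu]_r ((1 - cos (r * xi)) * riesz_kernel s r)) E1 -EFinM.
  congr EFin.
  rewrite !normrM ger0_norm ?(ltW (stable_const_gt0 s0 s1))// [X in _ * (X * _)]ger0_norm ?powR_ge0//.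
  by ring.
rewrite (fraclapE s x iff) mulrCA -(lebesgue_RintegralZl (stable_const s) isc).
have -> : \int[mu]_xi (stable_const s * (`|xi| `^ (2 * s) * cosT f x xi)) =
  \int[mu]_xi \int[mu]_r (cosT f x xi * ((1 - cos (r * xi)) * riesz_kernel s r)).
  apply: eq_Rintegral => xi _.
  have [i1 E1] := stable_const_scale xi s0 s1.
  by rewrite (lebesgue_RintegralZl (cosT f x xi) i1) E1; ring.
have iF2 := (Rintegral_fubini_F (integrable_prod_swap iF)).1.
rewrite (Rintegral_exchange iF) -lebesgue_RintegralZl; last exact: iF2.
rewrite /F /=; clear iF2 iF mF F.
apply: eq_Rintegral => r _.
have -> : \int[mu]_xi (cosT f x xi * ((1 - cos (r * xi)) * riesz_kernel s r)) =
  \int[mu]_xi (riesz_kernel s r * (cosT f x xi - 2^-1 * (cosT f (x + r) xi + cosT f (x - r) xi))).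
  by apply: eq_Rintegral => xi _; rewrite -cosT_shift_average//; ring.
have i2 : mu.-integrable setT (EFin \o (fun xi => cosT f (x + r) xi + cosT f (x - r) xi)).
  exact: RintegrableD.
have i3 := RintegrableZl 2^-1 i2.
rewrite (lebesgue_RintegralZl _ (RintegrableB (iA x) i3)).
rewrite (lebesgue_RintegralB (iA x) i3) (lebesgue_RintegralZl _ i2).
rewrite (lebesgue_RintegralD (iA _) (iA _)).
rewrite !(cosT_inversion _ M0 Hf).
move: (@pi_gt0 R); move: (pi : R) => p p0.
by field; rewrite (gt_eqF p0).
Qed.

End inversion.

(** * The fractional Laplacian off the support *)

Section off_support.
Context {R : realType}.
Notation mu := (@lebesgue_measure R).
Implicit Types (f : R -> R) (s x xi M K : R).

Lemma integrable_riesz_right f s x d : 0 < s -> 0 < d ->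
  mu.-integrable setT (EFin \o f) -> (forall y, x - d < y -> f y = 0) ->
  mu.-integrable setT (EFin \o (fun y => f y * riesz_kernel s (x - y))).
Proof.
move=> s0 d0 iff fd.
apply: (lebesgue_dominated_integrable _ _ (RintegrableZl (riesz_kernel s d) (integrable_norm iff))).
  apply: measurable_funM; first exact: Rintegrable_measurable.
  apply: (measurableT_comp (f := riesz_kernel s)); first exact: measurable_riesz_kernel.
  exact: measurable_funB.
move=> y; have [xy|yx] := ltP (x - d) y.
  by rewrite fd// mul0r normr0 mulr_ge0 ?riesz_kernel_ge0/=.
rewrite normrM mulrC (ger0_norm (riesz_kernel_ge0 _ _)) ler_wpM2r//=.
by apply: riesz_kernel_le => //; lra.
Qed.

(** To the right of the support f(x) and f(x + r) vanish, and only f(x - r)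
    survives in the singular integral. *)
Lemma fraclap_right M K f s x d : 0 <= M -> C4_supported M K f -> 0 < s -> s < 1 ->
  0 < d -> (forall y, x - d < y -> f y = 0) ->
  fraclap s f x = - ((2 * stable_const s)^-1 * \int[mu]_y (f y * riesz_kernel s (x - y))).
Proof.
move=> M0 Hf s0 s1 d0 fd.
have ik := integrable_riesz_right s0 d0 (C4_integrable Hf) fd.
have h := fraclap_singular_integral x M0 Hf s0 s1.
have c0 := stable_const_gt0 s0 s1.
have N1 : (-1 : R) != 0 by rewrite oppr_eq0 oner_eq0.
apply: (mulfI (lt0r_neq0 c0)); rewrite h.
rewrite (Rintegral_affine x N1 ik) normrN1 mul1r.
have ik' := integrable_affine x N1 ik.
rewrite [RHS](_ : _ = - (2^-1) * \int[mu]_r (f (-1 * r + x) * riesz_kernel s (x - (-1 * r + x)))).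
  rewrite -(lebesgue_RintegralZl _ ik'); apply: eq_Rintegral => r _.
  rewrite (_ : x - (-1 * r + x) = r); last by ring.
  rewrite (_ : -1 * r + x = x - r); last by ring.
  rewrite (fd x) ?ltrBlDr ?ltrDl//.
  rewrite /riesz_kernel; case: ifPn => r0; last by rewrite !mul0r mulr0 mulr0.
  rewrite (fd (x + r)); first by ring.
  lra.
by field; rewrite (lt0r_neq0 c0).
Qed.

Lemma C4_reflect M K f : C4_supported M K f -> C4_supported M K (fun y => f (- y)).
Proof.
move=> [[f1 [f2 [f3 [f4 [d1 d2 d3 d4 [s1 s2 s3 s4 [c4 b4]]]]]]] s0 b0].
have dN (g g' : R -> R) : (forall y : R, is_derive y (1 : R) g (g' y)) ->
   forall y : R, is_derive y (1 : R) (fun y => g (- y)) (- g' (- y)).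
  move=> dg y.
  have := @is_derive1_comp R g (fun y => - y) y _ _ (dg (- y)) (is_deriveNid y (1:R)).
  by rewrite mulrN1.
have dN' (g g' : R -> R) : (forall y : R, is_derive y (1 : R) g (g' y)) ->
   forall y : R, is_derive y (1 : R) (fun y => - g (- y)) (g' (- y)).
  move=> dg y; have := is_deriveN (dN _ _ dg y).
  by rewrite opprK.
split.
- exists (fun y => - f1 (- y)), (fun y => f2 (- y)), (fun y => - f3 (- y)), (fun y => f4 (- y)).
  split; [exact: dN|exact: dN'|exact: dN|exact: dN'|].
  split.
  + by move=> y My; rewrite s1 ?normrN// oppr0.
  + by move=> y My; rewrite s2 ?normrN.
  + by move=> y My; rewrite s3 ?normrN// oppr0.
  + by move=> y My; rewrite s4 ?normrN.
  + split; last by move=> y.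
    move=> y; apply: (@continuous_comp _ _ _ -%R f4); first exact: opp_continuous.
    exact: c4.
- by move=> y My; rewrite s0 ?normrN.
- by move=> y.
Qed.

Lemma fraclap_reflect s f x : mu.-integrable setT (EFin \o f) ->
  fraclap s (fun y => f (- y)) x = fraclap s f (- x).
Proof.
move=> iff; have iN := integrable_reflect iff.
rewrite (fraclapE s x iN) (fraclapE s (- x) iff); apply: (congr1 (fun r => (2 * pi)^-1 * r)).
apply: eq_Rintegral => xi _; congr (_ * _).
rewrite /cosT -(Rintegral_reflect (integrable_cosT (- x) xi iff)).
apply: eq_Rintegral => y _; congr (_ * _).
by rewrite -cosN; congr cos; ring.
Qed.

(** The mirror image of the previous case. *)
Lemma fraclap_left M K f s x d : 0 <= M -> C4_supported M K f -> 0 < s -> s < 1 ->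
  0 < d -> (forall y, y < x + d -> f y = 0) ->
  fraclap s f x = - ((2 * stable_const s)^-1 * \int[mu]_y (f y * riesz_kernel s (y - x))).
Proof.
move=> M0 Hf s0 s1 d0 fd.
have iff := C4_integrable Hf.
have gd y : - x - d < y -> f (- y) = 0 by move=> h; apply: fd; lra.
have := fraclap_right M0 (C4_reflect Hf) s0 s1 d0 gd.
rewrite (fraclap_reflect s (- x) iff) opprK => ->.
apply: (congr1 (fun r => - ((2 * stable_const s)^-1 * r))).
have ik := integrable_riesz_right s0 d0 (integrable_reflect iff) gd.
rewrite -(Rintegral_reflect ik).
by apply: eq_Rintegral => y _; rewrite opprK; congr (_ * riesz_kernel _ _); ring.
Qed.

Lemma fraclap_far M K f s x : 0 <= M -> C4_supported M K f -> 0 < s -> s < 1 ->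
  M < `|x| ->
  `|fraclap s f x| <= K * (M / stable_const s * riesz_kernel s (`|x| - M)).
Proof.
move=> M0 Hf s0 s1.
wlog x0 : f x Hf / 0 <= x => [hw|].
  have [x0|x0 Mx] := leP 0 x; first exact: hw.
  have := fraclap_reflect s (- x) (C4_integrable Hf); rewrite opprK => <-.
  rewrite -(normrN x) in Mx *; apply: hw => //; first exact: C4_reflect.
  lra.
rewrite ger0_norm// => Mx.
have c0 := stable_const_gt0 s0 s1.
have d0 : 0 < x - M by rewrite subr_gt0.
have fd y : x - (x - M) < y -> f y = 0.
  move=> h; apply: (C4_supp Hf); apply: (@lt_le_trans _ _ y); [lra|exact: ler_norm].
rewrite (fraclap_right M0 Hf s0 s1 d0 fd) normrN normrM gtr0_norm; last first.
  by rewrite invr_gt0 mulr_gt0.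
have ik := integrable_riesz_right s0 d0 (C4_integrable Hf) fd.
have : `|\int[mu]_y (f y * riesz_kernel s (x - y))| <= 2 * M * (K * riesz_kernel s (x - M)).
  apply: le_Rintegral_vanishes_beyond => //.
  - exact: Rintegrable_measurable ik.
  - by move=> y My; rewrite (C4_supp Hf)// mul0r.
  - move=> y; have [xy|yx] := ltP (x - (x - M)) y.
      rewrite fd// mul0r normr0 mulr_ge0 ?riesz_kernel_ge0//.
      exact: le_trans (normr_ge0 _) (C4_bound Hf y).
    rewrite normrM (ger0_norm (riesz_kernel_ge0 _ _)).
    apply: ler_pM => //; [exact: riesz_kernel_ge0|exact: C4_bound Hf y|].
    by apply: riesz_kernel_le => //; lra.
move=> h; rewrite ler_pdivrMl ?mulr_gt0//.
apply: (le_trans h); rewrite le_eqVlt; apply/orP; left; apply/eqP.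
by field; rewrite (lt0r_neq0 c0).
Qed.

(** A bound independent of the function, up to the factor K: it serves for all
    time slices of a test function at once and makes the weak formulation
    absolutely integrable on the strip. *)
Lemma fraclap_dominated s M : 0 < s -> s < 1 -> 0 <= M ->
  exists W : R -> R, [/\ mu.-integrable setT (EFin \o W), forall x, 0 <= W x &
   forall K f, C4_supported M K f -> forall x, `|fraclap s f x| <= K * W x].
Proof.
move=> s0 s1 M0.
have q1 : 1 < 1 + 2 * s by lra.
pose tail r : R := if 1 < r then r `^ (- (1 + 2 * s)) else 0.
have it : mu.-integrable setT (EFin \o tail) := integrable_powR_tail q1.
have N1 : (-1 : R) != 0 by rewrite oppr_eq0 oner_eq0.
have it1 := integrable_shift (- M) it.
have it2 := integrable_affine (- M) N1 it.
have c0 := stable_const_gt0 s0 s1.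
(* The global bound on [-M - 1, M + 1]; outside, the distance to the support
   exceeds 1 and the integrable tail of the kernel takes over. *)
pose W x := 4 * M * \1_(`[- (M + 1), M + 1]%classic : set R) x +
   M / stable_const s * (tail (x + - M) + tail (-1 * x + - M)).
have tail_ge0 r : 0 <= tail r by rewrite /tail; case: ifP => // _; exact: powR_ge0.
have Mc0 : 0 <= M / stable_const s by rewrite divr_ge0// ltW.
have ii : mu.-integrable setT (EFin \o (\1_(`[- (M + 1), M + 1]%classic : set R) : R -> R)).
  exact: (@integrable_indic_itv R (- (M + 1)) (M + 1) true false).
exists W; split.
- apply: RintegrableD; first exact: RintegrableZl ii.
  by apply: RintegrableZl; exact: RintegrableD.
- move=> x; rewrite /W; apply: addr_ge0; first by rewrite !mulr_ge0.
  by apply: mulr_ge0 => //; apply: addr_ge0.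
- move=> K f Hf x; rewrite /W.
  have K0 : 0 <= K by exact: le_trans (normr_ge0 _) (C4_bound Hf 0).
  rewrite mulrDr; have [xM|xM] := leP `|x| (M + 1).
    rewrite indicE mem_set ?mulr1; last by rewrite /= in_itv/= -ler_norml.
    apply: (le_trans (fraclap_le x M0 Hf s0 s1)).
    rewrite (_ : K * (4 * M) = 4 * M * K); last by ring.
    by rewrite lerDl mulr_ge0// mulr_ge0// addr_ge0.
  apply: (le_trans (fraclap_far M0 Hf s0 s1 _)); first lra.
  rewrite -[leLHS]add0r lerD ?mulr_ge0//.
  apply: ler_wpM2l => //; apply: ler_wpM2l => //.
  have -> : riesz_kernel s (`|x| - M) = tail (`|x| - M).
    by rewrite /riesz_kernel /tail !ifT//; lra.
  have [x0|x0] := leP 0 x; first by rewrite (ger0_norm x0) lerDl tail_ge0.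
  by rewrite (ltr0_norm x0) mulN1r lerDr tail_ge0.
Qed.

(** A nonnegative f supported in ]a1, a2[, to the right of 0, is nearer to x
    than to -x. Off the support the fractional Laplacian is minus the potential
    of f, and that potential is larger at the nearer point. *)
Lemma fraclap_antisymmetric_lt M K f s x b a1 a2 : 0 <= M -> C4_supported M K f ->
  0 < s -> s < 1 -> 0 < a1 -> a1 < a2 -> a2 < b -> b <= x ->
  (forall y, 0 <= f y) -> (forall y, a1 < y -> y < a2 -> 0 < f y) ->
  (forall y, y <= a1 -> f y = 0) -> (forall y, a2 <= y -> f y = 0) ->
  fraclap s f x < fraclap s f (- x).
Proof.
move=> M0 Hf s0 s1 a10 a12 a2b bx f0 fpos fl fr.
have c0 := stable_const_gt0 s0 s1.
have iff := C4_integrable Hf.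
have d0 : 0 < x - a2 by lra.
have fd y : x - (x - a2) < y -> f y = 0 by move=> h; apply: fr; lra.
have fd' y : y < - x + x -> f y = 0 by move=> h; apply: fl; lra.
have x0 : 0 < x by lra.
have gd y : - - x - x < y -> f (- y) = 0 by move=> h; apply: fd'; lra.
rewrite (fraclap_right M0 Hf s0 s1 d0 fd) (fraclap_left M0 Hf s0 s1 x0 fd').
have k0 : 0 < (2 * stable_const s)^-1 by rewrite invr_gt0 mulr_gt0.
rewrite ltrN2 (ltr_pM2l k0) -subr_gt0.
have i1 := integrable_riesz_right s0 d0 iff fd.
have i2 : mu.-integrable setT (EFin \o (fun y => f y * riesz_kernel s (y - - x))).
  have := integrable_reflect (integrable_riesz_right s0 x0 (integrable_reflect iff) gd).
  rewrite (_ : (fun _ => _) = (fun y => f y * riesz_kernel s (y - - x)))//.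
  by apply/funext => y; rewrite !opprK addrC.
rewrite -(lebesgue_RintegralB i1 i2).
have i3 := RintegrableB i1 i2.
apply: (lebesgue_Rintegral_gt0 a12 i3).
- move=> y; rewrite -mulrBr.
  have [ya|ay] := leP y a1; first by rewrite fl// mul0r.
  have [ya2|ay2] := leP a2 y; first by rewrite fr// mul0r.
  by rewrite mulr_ge0// subr_ge0; apply: riesz_kernel_le => //; lra.
- move=> y ay ya2; rewrite -mulrBr mulr_gt0 ?fpos// subr_gt0.
  by apply: riesz_kernel_lt => //; lra.
Qed.

End off_support.

(** * Test functions and their slices *)

Section test_functions.
Context {R : realType}.
Notation mu := (@lebesgue_measure R).

Lemma smooth_continuous (V : normedModType R) (f : V -> R) : smooth f -> continuous f.
Proof. by move=> /(_ 0%N). Qed.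

Lemma smooth_derivable (V : normedModType R) (f : V -> R) (v x : V) :
  smooth f -> derivable f x v.
Proof. by move=> /(_ 1%N) [_ /(_ v) []]. Qed.

Lemma smooth_derive (V : normedModType R) (f : V -> R) (v : V) :
  smooth f -> smooth (fun x => 'D_v f x).
Proof. by move=> sf k; have [_ /(_ v) []] := sf k.+1. Qed.

Lemma derive_locally0 (V : normedModType R) (f : V -> R) (x v : V) :
  (\forall y \near x, f y = 0) -> 'D_v f x = 0.
Proof.
move=> fx0; rewrite (@near_eq_derive _ _ _ f (cst 0)).
  exact: derive_cst.
by [].
Qed.

Lemma fsupp_derive (V : normedModType R) (f : V -> R) (v : V) :
  fsupp (fun x => 'D_v f x) `<=` fsupp f.
Proof.
have e : fsupp f = closure (fsupp f) by apply/closure_id; exact: closed_closure.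
rewrite e.
apply: closure_subset => x /= Dx; apply: contrapT => Nx.
move/eqP : Dx; apply; apply: derive_locally0.
have : nbhs x (~` closure [set x | f x != 0]).
  by apply: open_nbhs_nbhs; split => //; apply: closed_openC; exact: closed_closure.
apply: filterS => y Ny; apply/eqP; apply: contrapT => /negP fy.
by apply: Ny; exact: subset_closure.
Qed.

Lemma test_function_derive (V : normedModType R) (O : set V) (f : V -> R) (v : V) :
  test_function O f -> test_function O (fun x => 'D_v f x).
Proof.
move=> [sf cf fO]; split.
- exact: smooth_derive.
- apply: (subclosed_compact _ cf); first exact: closed_closure.
  exact: fsupp_derive.
- by apply: subset_trans fO; exact: fsupp_derive.
Qed.

(** The derivative only depends on the values near a point, and |x| > M is an
    open condition. *)
Lemma vanishes_beyond_derive (M : R) (f f' : R -> R) :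
  (forall x : R, is_derive x (1 : R) f (f' x)) -> vanishes_beyond M f ->
  vanishes_beyond M f'.
Proof.
move=> df sf x Mx; have [_ <-] := df x; apply: derive_locally0.
have : nbhs x [set y : R | M < `|y|].
  have o : open [set y : R | M < `|y|].
    rewrite (_ : [set y : R | M < `|y|] = (fun y => `|y|) @^-1` [set z | M < z])//.
    by apply: open_comp; [move=> y _; exact: norm_continuous|exact: open_gt].
  by apply: open_nbhs_nbhs; split.
by apply: filterS => y /= /sf.
Qed.

Lemma is_derive_slice (f : R * R -> R) (y t : R) :
  derivable f (y, t) (1, 0) ->
  is_derive y (1 : R) (fun y => f (y, t)) ('D_(1, 0) f (y, t)).
Proof.
have E : (fun h : R => h^-1 *: (((fun y => f (y, t)) \o shift y) (h *: (1:R)) - f (y, t))) =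
   (fun h : R => h^-1 *: ((f \o shift (y, t)) (h *: (1, 0)) - f (y, t))).
  apply/funext => h /=; congr (_ *: (f _ - _)).
  by apply: injective_projections => //=; rewrite ?scaler0 ?add0r.
move=> df; split.
  by rewrite /derivable E.
by rewrite /derive E.
Qed.

Lemma is_derive_slice2 (f : R * R -> R) (y t : R) :
  derivable f (y, t) (0, 1) ->
  is_derive t (1 : R) (fun t => f (y, t)) ('D_(0, 1) f (y, t)).
Proof.
have E : (fun h : R => h^-1 *: (((fun t => f (y, t)) \o shift t) (h *: (1:R)) - f (y, t))) =
   (fun h : R => h^-1 *: ((f \o shift (y, t)) (h *: (0, 1)) - f (y, t))).
  apply/funext => h /=; congr (_ *: (f _ - _)).
  by apply: injective_projections => //=; rewrite ?scaler0 ?add0r.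
move=> df; split.
  by rewrite /derivable E.
by rewrite /derive E.
Qed.

Lemma test_function_bounds (V : normedModType R) (O : set V) (f : V -> R) :
  test_function O f -> exists M K : R, [/\ 0 <= M, 0 <= K,
    forall x, M < `|x| -> f x = 0 & forall x, `|f x| <= K].
Proof.
move=> [sf cf _]; have [M [M0 fM]] := fsupp_bounded cf.
have [K [K0 fK]] := continuous_fsupp_bounded (smooth_continuous sf) cf.
by exists M, K.
Qed.

Lemma test_function_C4 (O : set R) (f : R -> R) : test_function O f ->
  exists M K : R, 0 <= M /\ C4_supported M K f.
Proof.
move=> tf.
pose f1 := fun x => 'D_1 f x; pose f2 := fun x => 'D_1 f1 x.
pose f3 := fun x => 'D_1 f2 x; pose f4 := fun x => 'D_1 f3 x.
have t1 : test_function O f1 by exact: test_function_derive.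
have t2 : test_function O f2 by exact: test_function_derive.
have t3 : test_function O f3 by exact: test_function_derive.
have t4 : test_function O f4 by exact: test_function_derive.
have [M [K [M0 K0 fM fK]]] := test_function_bounds tf.
have [_ [K4 [_ K40 _ f4K]]] := test_function_bounds t4.
have d (g : R -> R) : test_function O g -> forall y : R, is_derive y (1 : R) g ('D_1 g y).
  by move=> [sg _ _] y; split => //; exact: smooth_derivable.
exists M, (Num.max K K4); split => //.
have s1 := vanishes_beyond_derive (d _ tf) fM.
have s2 := vanishes_beyond_derive (d _ t1) s1.
have s3 := vanishes_beyond_derive (d _ t2) s2.
have s4 := vanishes_beyond_derive (d _ t3) s3.
split; [|exact: fM|by move=> y; rewrite le_max fK].
exists f1, f2, f3, f4; split; [exact: d|exact: d|exact: d|exact: d|].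
split; [exact: s1|exact: s2|exact: s3|exact: s4|].
split; last by move=> y; rewrite le_max f4K orbT.
by case: t4 => /smooth_continuous.
Qed.

Lemma pair_norm_gt1 (M y t : R) : M < `|y| -> M < `|(y, t)|.
Proof. by move=> My; rewrite prod_normE/= lt_max My. Qed.

(** The x-derivatives of the slices are slices of directional derivatives of f,
    which are again test functions; their bounds do not depend on t. *)
Lemma test_function_slice_C4 (O : set (R * R)) (f : R * R -> R) : test_function O f ->
  exists M K : R, 0 <= M /\ forall t, C4_supported M K (fun y => f (y, t)).
Proof.
move=> tf.
pose D (g : R * R -> R) := fun p => 'D_(1, 0) g p.
have tD g : test_function O g -> test_function O (D g) by exact: test_function_derive.
have t1 := tD _ tf; have t2 := tD _ t1; have t3 := tD _ t2; have t4 := tD _ t3.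
have [M [K [M0 K0 fM fK]]] := test_function_bounds tf.
have [_ [K4 [_ K40 _ f4K]]] := test_function_bounds t4.
have d g t : test_function O g ->
    forall y : R, is_derive y (1 : R) (fun y => g (y, t)) (D g (y, t)).
  by move=> [sg _ _] y; apply: is_derive_slice; exact: smooth_derivable.
exists M, (Num.max K K4); split => // t.
have s0 : vanishes_beyond M (fun y => f (y, t)).
  by move=> y My; apply: fM; exact: pair_norm_gt1.
have s1 := vanishes_beyond_derive (d _ _ tf) s0.
have s2 := vanishes_beyond_derive (d _ _ t1) s1.
have s3 := vanishes_beyond_derive (d _ _ t2) s2.
have s4 := vanishes_beyond_derive (d _ _ t3) s3.
split; [|exact: s0|by move=> y; rewrite le_max fK].
exists (fun y => D f (y, t)), (fun y => D (D f) (y, t)),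
  (fun y => D (D (D f)) (y, t)), (fun y => D (D (D (D f))) (y, t)).
split; [exact: d|exact: d|exact: d|exact: d|].
split; [exact: s1|exact: s2|exact: s3|exact: s4|].
split; last by move=> y; rewrite le_max f4K orbT.
move=> y; apply: (@continuous_comp _ _ _ (fun y => (y, t)) (D (D (D (D f))))).
  by apply: (@cvg_pair _ _ _ _ (nbhs y) (nbhs t)); [exact: cvg_id|exact: cvg_cst].
by case: t4 => /smooth_continuous + _ _; apply.
Qed.

(** The topology of the plane has a countable base of squares with rational
    centres and radii, and these are measurable for the product structure. *)
Lemma open_prod_measurable (A : set (R * R)) : open A -> measurable A.
Proof.
move=> oA.
pose box (q : rat * rat * rat) : set (R * R) :=
  ball (ratr q.1.1 : R) (ratr q.2 : R) `*` ball (ratr q.1.2 : R) (ratr q.2 : R).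
have -> : A = \bigcup_(q in [set q | box q `<=` A]) box q.
  apply/seteqP; split => [[x y] Axy|p [q + qp]]; last exact.
  have : nbhs (x, y) A by apply: open_nbhs_nbhs.
  rewrite -nbhs_ballE => -[e /= e0 Ae].
  have e20 : 0 < e / 2 by rewrite divr_gt0.
  have [r /andP[r0 re]] : exists r : rat, 0 < (ratr r : R) < e / 2.
    by have [r] := rat_in_itvoo e20; rewrite in_itv/= => h; exists r.
  have [qx hx] : exists q : rat, ball (ratr q : R) (ratr r : R) x.
    have : x - ratr r < x + ratr r by lra.
    move=> /rat_in_itvoo[q]; rewrite in_itv/= => /andP[h1 h2]; exists q.
    by rewrite /ball/= ltr_norml; apply/andP; split; lra.
  have [qy hy] : exists q : rat, ball (ratr q : R) (ratr r : R) y.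
    have : y - ratr r < y + ratr r by lra.
    move=> /rat_in_itvoo[q]; rewrite in_itv/= => /andP[h1 h2]; exists q.
    by rewrite /ball/= ltr_norml; apply/andP; split; lra.
  exists (qx, qy, r); last by split.
  move=> [u v] [/= hu hv]; apply: Ae; split => /=.
  - move: hx hu; rewrite /ball/= !ltr_norml => /andP[? ?] /andP[? ?].
    by apply/andP; split; lra.
  - move: hy hv; rewrite /ball/= !ltr_norml => /andP[? ?] /andP[? ?].
    by apply/andP; split; lra.
rewrite bigcup_mkcond; apply: countable_bigcupT_measurable; first exact: countableP.
move=> q; case: ifP => // _.
by apply: measurableX; exact: measurable_ball.
Qed.

Lemma continuous_prod_measurable (f : R * R -> R) :
  continuous f -> measurable_fun setT f.
Proof.
move=> /continuousP cf; apply: (measurability _ (RGenOpens.measurableE R)).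
move=> _ [_ [a [b ->] <-]]; rewrite setTI; apply: open_prod_measurable.
exact/cf/interval_open.
Qed.

(** The symmetry x -> -x of space-time. *)
Definition flip (p : R * R) : R * R := (- p.1, p.2).

Lemma flipK : involutive flip.
Proof. by case=> x t; rewrite /flip/= opprK. Qed.

Lemma continuous_flip : continuous flip.
Proof.
move=> p; apply: (@cvg_pair _ _ _ _ (nbhs (- p.1)) (nbhs p.2)).
  by apply: cvgN; exact: cvg_fst.
exact: cvg_snd.
Qed.

Lemma measurable_flip : measurable_fun setT flip.
Proof.
apply: measurable_fun_pair; last exact: measurable_snd.
by apply: measurable_funN; exact: measurable_fst.
Qed.

(** The flip is linear, so the difference quotients of the two functions are the
    same. *)
Lemma derive_flip (f : R * R -> R) (p v : R * R) : derivable f (flip p) (flip v) ->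
  derivable (f \o flip) p v /\ 'D_v (f \o flip) p = 'D_(flip v) f (flip p).
Proof.
have E : (fun h : R => h^-1 *: (((f \o flip) \o shift p) (h *: v) - (f \o flip) p)) =
   (fun h : R => h^-1 *: ((f \o shift (flip p)) (h *: flip v) - f (flip p))).
  apply/funext => h /=; congr (_ *: (f _ - _)).
  apply: injective_projections => //=.
  by rewrite opprD scalerN.
move=> df; split; first by rewrite /derivable E.
by rewrite /derive E.
Qed.

Lemma Ck_flip k (f : R * R -> R) : Ck k f -> Ck k (f \o flip).
Proof.
elim: k f => [|k IH] f.
  by move=> cf p; apply: continuous_comp; [exact: continuous_flip|exact: cf].
move=> [cf df]; split.
  by move=> p; apply: continuous_comp; [exact: continuous_flip|exact: cf].
move=> v; have [d1 d2] := df (flip v).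
split; first by move=> p; apply: (derive_flip (d1 _)).1.
rewrite (_ : (fun p => _) = (fun p => 'D_(flip v) f p) \o flip); first exact: IH.
by apply/funext => p; rewrite (derive_flip (d1 _)).2.
Qed.

Lemma spacetime_test_flip (T : R) (f : R * R -> R) :
  spacetime_test T f -> spacetime_test T (f \o flip).
Proof.
move=> [sf cf fO].
have sub : fsupp (f \o flip) `<=` flip @` fsupp f.
  have cfl : compact (flip @` fsupp f).
    by apply: continuous_compact => //; apply: continuous_subspaceT; exact: continuous_flip.
  have e : flip @` fsupp f = closure (flip @` fsupp f).
    by apply/closure_id; apply: compact_closed => //; exact: norm_hausdorff.
  rewrite e; apply: closure_subset => p /= fp.
  by exists (flip p); [exact: subset_closure|exact: flipK].
split.
- by move=> k; exact: Ck_flip.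
- apply: (subclosed_compact _ _ sub); first exact: closed_closure.
  by apply: continuous_compact => //; apply: continuous_subspaceT; exact: continuous_flip.
- by move=> p /sub[q /fO/= qT <-].
Qed.

End test_functions.

(** * The integrand of the weak formulation *)

Section weak_formulation.
Context {R : realType}.
Notation mu := (@lebesgue_measure R).
Notation mu2 := ((@lebesgue_measure R) \x (@lebesgue_measure R))%E.
Implicit Types (s T L P : R) (psi h : R * R -> R).

Lemma measurable_fraclap_slices s (O : set (R * R)) psi : test_function O psi ->
  measurable_fun setT (fun p : R * R => fraclap s (fun y => psi (y, p.2)) p.1).
Proof.
move=> tpsi; have [M [K [M0 Hs]]] := test_function_slice_C4 tpsi.
have mpsi : measurable_fun setT psi.
  by apply: continuous_prod_measurable; case: tpsi => /smooth_continuous.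
pose F (q : measurableTypeR R * measurableTypeR R) := psi (q.2, q.1).
have mF : measurable_fun setT F.
  apply: (measurableT_comp (f := psi)) => //.
  by apply: measurable_fun_pair; [exact: measurable_snd|exact: measurable_fst].
have h := measurable_fraclap_family s mF (fun t => C4_integrable (Hs t)).
apply: (measurableT_comp h (f := fun p => _) (g := fun p : R * R => (p.2, p.1))).
by apply: measurable_fun_pair; [exact: measurable_snd|exact: measurable_fst].
Qed.

Lemma ae_imply (P Q : R * R -> Prop) : (forall p, P p -> Q p) ->
  {ae mu2, forall p, P p} -> {ae mu2, forall p, Q p}.
Proof.
move=> PQ [N [mN N0 PN]]; exists N; split => // p nQ.
by apply: PN => /= Pp; apply: nQ; exact: PQ.
Qed.

(** The flip preserves the product measure, hence null sets. *)
Lemma ae_flip (Q : R * R -> Prop) :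
  {ae mu2, forall p, Q p} -> {ae mu2, forall p, Q (flip p)}.
Proof.
move=> [N [mN N0 QN]].
have mfN : measurable (flip @^-1` N).
  by rewrite -[_ @^-1` _]setTI; exact: measurable_flip.
exists (flip @^-1` N); split => //; last by move=> p /= /QN.
move: N0; rewrite /product_measure1.
have mphi : measurable_fun setT (mu \o xsection N) by exact: measurable_fun_xsection.
have N1 : (-1 : R) != 0 by rewrite oppr_eq0 oner_eq0.
rewrite (ge0_integral_affine 0 N1 mphi)//.
rewrite normrN1 mul1e => <-; apply: eq_integral => x _ /=.
by congr (mu _); apply/seteqP; split => y; rewrite /xsection/= !inE /flip/= mulN1r addr0.
Qed.

Lemma measurable_QT T : measurable (@QT R T).
Proof. by apply: measurableX => //; exact: measurable_itv. Qed.

(** The symmetry of the nonlinearity about the middle L/2 of the flat part of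
    its graph; the whole antisymmetry statement rests on this identity. *)
Lemma Phi2_sub L r : Phi2 L (L - r) = - Phi2 L r.
Proof.
rewrite /Phi2 (_ : L - r - L = - r); last by ring.
rewrite (_ : Num.max (- r) 0 = - Num.min r 0); last by rewrite oppr_min oppr0.
rewrite (_ : Num.min (L - r) 0 = - Num.max (r - L) 0); last by rewrite oppr_max oppr0 opprB.
ring.
Qed.

Lemma Phi2_le L r : 0 < L -> `|Phi2 L r| <= `|r|.
Proof.
move=> L0; rewrite /Phi2.
have [r0|r0] := leP r 0.
  rewrite (_ : Num.max (r - L) 0 = 0) ?add0r//.
  by apply/max_idPr; lra.
rewrite addr0 (gtr0_norm r0) ger0_norm ?le_max ?lexx ?orbT//.
by rewrite ge_max; apply/andP; split; lra.
Qed.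

Lemma measurable_Phi2 L : measurable_fun setT (Phi2 L).
Proof.
apply: measurable_funD.
  by apply: measurable_maxr => //; exact: measurable_funB.
exact: measurable_minr.
Qed.

(** Cutting h off outside the strip puts the time integral of the weak
    formulation on the whole line, where the exchange lemmas apply. *)
Definition vws_integrand s L T h psi (p : R * R) : R :=
  (h \_ (QT T)) p * 'D_(0, 1) psi p
  - Phi2 L ((h \_ (QT T)) p) * fraclap s (fun y => psi (y, p.2)) p.1.

Lemma Phi20 L : 0 < L -> Phi2 L 0 = 0.
Proof. by move=> L0; rewrite /Phi2 minxx addr0; apply/max_idPr; lra. Qed.

Lemma measurable_vws_integrand s L T h psi : measurable_fun (QT T) h ->
  spacetime_test T psi -> measurable_fun setT (vws_integrand s L T h psi).
Proof.
move=> mh tpsi.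
have mh' : measurable_fun setT (h \_ (QT T)).
  by apply/(measurable_restrictT _ (measurable_QT T)).
apply: measurable_funB; apply: measurable_funM => //.
- apply: continuous_prod_measurable.
  by case: (test_function_derive ((0, 1) : R * R) tpsi) => /smooth_continuous.
- by apply: (measurableT_comp (f := Phi2 L)) => //; exact: measurable_Phi2.
- exact: measurable_fraclap_slices tpsi.
Qed.

Lemma test_time_derivative_dominated T psi : spacetime_test T psi ->
  exists V : R -> R, [/\ mu.-integrable setT (EFin \o V), forall x, 0 <= V x &
    forall p, `|'D_(0, 1) psi p| <= V p.1].
Proof.
move=> /(test_function_derive ((0, 1) : R * R)) /test_function_bounds[M [K [M0 K0 fM fK]]].
exists (fun x => K * \1_(`[- M, M]%classic : set R) x); split.
- apply: RintegrableZl; exact: (@integrable_indic_itv R (- M) M true false).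
- by move=> x; rewrite mulr_ge0.
- move=> [x t]; rewrite indicE /=.
  case: (boolP (x \in _)) => [_|]; first by rewrite mulr1.
  rewrite notin_setE /= in_itv/= -ler_norml => /negP; rewrite -ltNge => Mx.
  by rewrite fM ?normr0 ?mulr0//; exact: pair_norm_gt1.
Qed.

Lemma integrable_time_window T :
  mu.-integrable setT (EFin \o (\1_(`]0, T[%classic : set R) : R -> R)).
Proof. exact: (@integrable_indic_itv R 0 T false true). Qed.

(** Both terms are bounded by a function of x alone, integrable in x, times the
    indicator of the time interval. *)
Lemma integrable_vws_integrand s L T h psi : 0 < s -> s < 1 -> 0 < L ->
  Linfty_QT T h -> spacetime_test T psi ->
  mu2.-integrable setT (EFin \o vws_integrand s L T h psi).
Proof.
move=> s0 s1 L0 [mh [B hB]] tpsi.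
have [V [iV V0 DV]] := test_time_derivative_dominated tpsi.
have [M [K [M0 Hs]]] := test_function_slice_C4 tpsi.
have [W [iW W0 fW]] := fraclap_dominated s0 s1 M0.
have K0 : 0 <= K by exact: le_trans (normr_ge0 _) (C4_bound (Hs 0) 0).
pose C := Num.max B 0.
have C0 : 0 <= C by rewrite le_max lexx orbT.
have iX := RintegrableZl C (RintegrableD iV (RintegrableZl K iW)).
have := integrable_prodM iX (integrable_time_window T).
apply: ae_dominated_integrable.
- exact: measurable_vws_integrand.
- apply: (ae_imply _ hB) => -[x t] {}hB /=.
  rewrite /vws_integrand patchE; case: ifPn => [|_].
    rewrite inE => Qxt; have [_ /= Tt] := Qxt; rewrite indicE mem_set// mulr1.
    have {}hB : `|h (x, t)| <= C by rewrite le_max hB.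
    have hb := fW _ _ (Hs t) x; have ha := DV (x, t).
    move: hb ha => /=; move: (fraclap s _ x) ('D_(0, 1) psi (x, t)) => b a hb ha.
    rewrite (le_trans (ler_normB _ _))// mulrDr !normrM.
    apply: lerD; apply: ler_pM => //.
    exact: le_trans (Phi2_le _ L0) hB.
  by rewrite Phi20// !mul0r subr0 normr0 !mulr_ge0// addr_ge0// mulr_ge0.
- by move=> p; rewrite /= !mulr_ge0// addr_ge0// mulr_ge0.
Qed.

Lemma spacetime_integral_vws s L T h psi : 0 < L ->
  \int[mu]_(t in `]0, T[) \int[mu]_x
     (h (x, t) * 'D_(0, 1) psi (x, t)
      - Phi2 L (h (x, t)) * fraclap s (fun y => psi (y, t)) x) =
  \int[mu]_t \int[mu]_x vws_integrand s L T h psi (x, t).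
Proof.
move=> L0; rewrite Rintegral_mkcond; apply: eq_Rintegral => t _.
rewrite patchE; case: ifPn => tT.
  apply: eq_Rintegral => x _; rewrite /vws_integrand patchE mem_set//.
  by split => //=; rewrite inE in tT.
transitivity (\int[mu]_(x in setT) (0 : R)); first by rewrite Rintegral_cst// mul0r.
apply: eq_Rintegral => x _; rewrite /vws_integrand patchE memNset; last first.
  by move=> [_ /=]; move: tT; rewrite notin_setE.
by rewrite Phi20// !mul0r subr0.
Qed.

Lemma integrable_vws_slices s L T h psi : 0 < s -> s < 1 -> 0 < L ->
  Linfty_QT T h -> spacetime_test T psi ->
  mu.-integrable setT (EFin \o (fun t => \int[mu]_x vws_integrand s L T h psi (x, t))) /\
  {ae mu, forall t, mu.-integrable setT (EFin \o (fun x => vws_integrand s L T h psi (x, t)))}.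
Proof.
move=> s0 s1 L0 hT tpsi; have iF := integrable_vws_integrand s0 s1 L0 hT tpsi.
split; first exact: (Rintegral_fubini_F (integrable_prod_swap iF)).1.
exact: ae_integrable2 iF.
Qed.

Definition time_derivative_cut T psi (p : R * R) : R :=
  'D_(0, 1) psi p * \1_(`]0, T[%classic : set R) p.2.

Lemma integrable_time_derivative_cut T psi : spacetime_test T psi ->
  mu2.-integrable setT (EFin \o time_derivative_cut T psi).
Proof.
move=> tpsi; have [V [iV V0 DV]] := test_time_derivative_dominated tpsi.
have := integrable_prodM iV (integrable_time_window T).
apply: dominated_integrable.
- apply: measurable_funM.
    apply: continuous_prod_measurable.
    by case: (test_function_derive ((0, 1) : R * R) tpsi) => /smooth_continuous.
  apply: (measurableT_comp (f := \1_(`]0, T[%classic : set R) : R -> R)); last exact: measurable_snd.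
  by apply: measurable_indic; exact: measurable_itv.
- by move=> p; rewrite normrM [X in _ * X]ger0_norm// ler_wpM2r.
Qed.

(** Integrate in time first; at t = T the test function vanishes. *)
Lemma time_derivative_integral T psi : 0 < T -> spacetime_test T psi ->
  \int[mu]_t \int[mu]_x time_derivative_cut T psi (x, t) = - \int[mu]_x psi (x, 0).
Proof.
move=> T0 tpsi.
rewrite -(Rintegral_exchange (integrable_time_derivative_cut tpsi)).
have [M [K [M0 Hs]]] := test_function_slice_C4 tpsi.
rewrite -mulN1r -(lebesgue_RintegralZl _ (C4_integrable (Hs 0))).
apply: eq_Rintegral => x _; rewrite mulN1r.
have [spsi cpsi Opsi] := tpsi.
have d t := is_derive_slice2 (@smooth_derivable R _ psi (0, 1) (x, t) spsi).
have cd : continuous (fun t : R => 'D_(0, 1) psi (x, t)).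
  move=> t; apply: (@continuous_comp _ _ _ (fun t => (x, t)) (fun p => 'D_(0, 1) psi p)).
    by apply: (@cvg_pair _ _ _ _ (nbhs x) (nbhs t)); [exact: cvg_cst|exact: cvg_id].
  exact: (smooth_continuous (@smooth_derive R _ psi (0, 1) spsi)).
have ct : continuous (fun t : R => psi (x, t)).
  by move=> t; apply: differentiable_continuous; apply/derivable1_diffP; case: (d t).
have -> : \int[mu]_t time_derivative_cut T psi (x, t) =
    \int[mu]_(t in `]0, T[) 'D_(0, 1) psi (x, t).
  rewrite [RHS]Rintegral_mkcond; apply: eq_Rintegral => t _.
  by rewrite /time_derivative_cut patchE indicE; case: (t \in _); rewrite ?mulr1 ?mulr0.
rewrite /Rintegral.
have -> : (\int[mu]_(t in `]0%R, T[) ('D_(0, 1) psi (x, t))%:E =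
    \int[mu]_(t in `[0%R, T]) ('D_(0, 1) psi (x, t))%:E)%E.
  apply/esym/integral_itv_bndoo.
  by apply/measurable_EFinP; apply: measurable_funTS; exact: continuous_measurable_fun cd.
rewrite (@continuous_FTC2 _ _ (fun t => psi (x, t)) 0 T T0).
- rewrite (_ : psi (x, T) = 0) ?sub0e//.
  apply/eqP; apply: contraT => psiT.
  have : fsupp psi (x, T) by exact: subset_closure.
  by move=> /Opsi /=; rewrite ltxx.
- exact: continuous_subspaceT.
- split.
  + by move=> t _; case: (d t).
  + by apply: cvg_at_right_filter; exact: ct.
  + by apply: cvg_at_left_filter; exact: ct.
- by move=> t _; rewrite derive1E; case: (d t).
Qed.

End weak_formulation.

(** * The symmetry of the equation *)

Section reflection.
Context {R : realType}.
Notation mu := (@lebesgue_measure R).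
Notation mu2 := ((@lebesgue_measure R) \x (@lebesgue_measure R))%E.
Implicit Types (s T L P : R) (psi h : R * R -> R).

(** The symmetry that preserves both the equation and the step datum: flip space
    and reflect the values about L/2. *)
Definition reflect L h (p : R * R) : R := L - h (flip p).

Lemma QT_flip T p : QT T (flip p) <-> QT T p.
Proof. by case: p => x t; split => -[_ /= h]; split. Qed.

Lemma Linfty_reflect T L h : Linfty_QT T h -> Linfty_QT T (reflect L h).
Proof.
move=> [mh [B hB]]; split.
  apply: measurable_funB => //.
  apply: (measurable_comp (measurable_QT T)) => //.
    by move=> _ [p /QT_flip Qp <-].
  exact: measurable_funTS measurable_flip.
exists (`|L| + B).
have := ae_flip hB; apply: ae_imply => p h1 Qp.
rewrite (le_trans (ler_normB _ _))// lerD2l.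
by apply: h1; exact/QT_flip.
Qed.

(** The constant L only meets the time derivative, since the nonlinearity is odd
    about L/2. *)
Lemma vws_integrand_reflect s L T h psi x t : 0 < L -> spacetime_test T psi ->
  vws_integrand s L T (reflect L h) psi (x, t) =
  L * time_derivative_cut T psi (x, t) - vws_integrand s L T h (psi \o flip) (- x, t).
Proof.
move=> L0 tpsi; have [spsi _ _] := tpsi.
have [M [K [M0 Hs]]] := test_function_slice_C4 tpsi.
rewrite /vws_integrand /time_derivative_cut.
have -> : fraclap s (fun y => (psi \o flip) (y, (- x, t).2)) (- x, t).1 =
    fraclap s (fun y => psi (y, t)) x.
  rewrite -[x in RHS]opprK -(fraclap_reflect s (- x) (C4_integrable (Hs t))).
  by [].
have -> : 'D_(0, 1) (psi \o flip) (- x, t) = 'D_(0, 1) psi (x, t).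
  have d : derivable psi (flip (- x, t)) (flip (0, 1)) by exact: smooth_derivable.
  rewrite (derive_flip d).2.
  by rewrite /flip/= oppr0 opprK.
rewrite [(x, t).1]/= [(x, t).2]/=.
move: (fraclap s _ x) ('D_(0, 1) psi (x, t)) => b a.
have [xt|xt] := boolP ((x, t) \in QT T).
  have xt' : (- x, t) \in QT T.
    by move: xt; rewrite !inE => -[_ ?]; split.
  rewrite !patchE xt xt' indicE mem_set; last by move: xt; rewrite inE => -[].
  rewrite /reflect Phi2_sub /flip/=; ring.
have xt' : (- x, t) \notin QT T.
  by apply: contra xt; rewrite !inE => -[_ ?]; split.
rewrite !patchE (negbTE xt) (negbTE xt') indicE memNset; last first.
  by move=> tT; move: xt; rewrite notin_setE; apply; split.
by rewrite Phi20// !mul0r !mulr0 !subr0.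
Qed.

Lemma ae_neq0 : {ae mu, forall x : R, x != 0}.
Proof.
exists [set 0 : R]; split => //; first exact: lebesgue_measure_set1.
by move=> x /= /negP; rewrite negbK => /eqP.
Qed.

Lemma measurable_step_datum L P : measurable_fun setT (step_datum L P).
Proof. by apply: measurable_fun_ifT => //; exact: measurable_fun_ler. Qed.

(** The datum at x and at -x adds up to L, except at x = 0. *)
Lemma step_datum_integral L P T psi : spacetime_test T psi ->
  \int[mu]_x (step_datum L P x * psi (x, 0)) =
  L * \int[mu]_x psi (x, 0) - \int[mu]_x (step_datum L P x * (psi \o flip) (x, 0)).
Proof.
move=> tpsi; have [M [K [M0 Hs]]] := test_function_slice_C4 tpsi.
have ipsi := C4_integrable (Hs 0).
pose C := `|L| + `|P|.
have hC x : `|step_datum L P x| <= C.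
  rewrite /step_datum /C; case: ifP => _; first exact: ler_normD.
  by rewrite normrN lerDr.
have i1 : mu.-integrable setT (EFin \o (fun x => psi (x, 0) * step_datum L P (- x))).
  apply: (integrableM_bounded (C := C)) => //.
  by apply: (measurableT_comp (f := step_datum L P)) => //; exact: measurable_step_datum.
have -> : \int[mu]_x (step_datum L P x * (psi \o flip) (x, 0)) =
    \int[mu]_x (psi (x, 0) * step_datum L P (- x)).
  rewrite -(Rintegral_reflect i1); apply: eq_Rintegral => x _.
  by rewrite opprK mulrC.
rewrite -(lebesgue_RintegralZl L ipsi) -(lebesgue_RintegralB (RintegrableZl L ipsi) i1).
apply: (@Rintegral_ae_eq _ (measurableTypeR R) R mu).
- apply: measurable_funM; first exact: measurable_step_datum.
  exact: Rintegrable_measurable ipsi.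
- exact: Rintegrable_measurable (RintegrableB (RintegrableZl L ipsi) i1).
- have [N [mN N0 hN]] := ae_neq0; exists N; split => // x nx; apply: hN => x0; apply: nx; move: x0.
  rewrite /= /step_datum oppr_le0; case: (ltgtP x 0) => // _ _; ring.
Qed.

Lemma Rintegral_subZ_reflect L (f g : R -> R) :
  mu.-integrable setT (EFin \o f) -> mu.-integrable setT (EFin \o g) ->
  \int[mu]_x (L * f x - g (- x)) = L * \int[mu]_x f x - \int[mu]_x g x.
Proof.
move=> iF iG.
rewrite (lebesgue_RintegralB (RintegrableZl L iF) (integrable_reflect iG)).
by rewrite (Rintegral_reflect iG) (lebesgue_RintegralZl L iF).
Qed.

(** Test the equation of h with the flipped test function. The two contributions
    of the constant L, one from the time derivative and one from the datum,
    cancel each other. *)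
Lemma very_weak_solution_reflect s T L P h : 0 < s -> s < 1 -> 0 < L -> 0 < T ->
  very_weak_solution s T (Phi2 L) (step_datum L P) h ->
  very_weak_solution s T (Phi2 L) (step_datum L P) (reflect L h).
Proof.
move=> s0 s1 L0 T0 [hT hw]; split; first exact: Linfty_reflect.
move=> psi tpsi.
have tpsi' := spacetime_test_flip tpsi.
set D := \int[mu]_x (step_datum L P x * (psi \o flip) (x, 0)).
have h0 := hw _ tpsi'.
have e0 := spacetime_integral_vws s T h (psi \o flip) L0.
have {e0}h0 := eq_trans (congr1 (fun r => r + D) (esym e0)) h0.
apply: (eq_trans (congr1 (fun r => r + _) (spacetime_integral_vws s T (reflect L h) psi L0))).
rewrite (step_datum_integral L P tpsi) -/D.
clear hw.
have itd := integrable_time_derivative_cut tpsi.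
have [iV aeV] := integrable_vws_slices s0 s1 L0 hT tpsi'.
have iA := (Rintegral_fubini_F (integrable_prod_swap itd)).1.
have aeA := ae_integrable2 itd.
have mG := measurable_vws_integrand s L (Linfty_reflect L hT).1 tpsi.
have E : \int[mu]_t \int[mu]_x vws_integrand s L T (reflect L h) psi (x, t) =
   \int[mu]_t (L * \int[mu]_x time_derivative_cut T psi (x, t) -
     \int[mu]_x vws_integrand s L T h (psi \o flip) (x, t)).
  apply: (@Rintegral_ae_eq _ (measurableTypeR R) R mu).
  - apply: (@measurable_Rintegral_param _ _ (measurableTypeR R) (measurableTypeR R) R mu
      (fun p => vws_integrand s L T (reflect L h) psi (p.2, p.1))).
    apply: (measurableT_comp mG).
    by apply: measurable_fun_pair; [exact: measurable_snd|exact: measurable_fst].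
  - exact: Rintegrable_measurable (RintegrableB (RintegrableZl L iA) iV).
  - have := @filterI _ _ (ae_filter_ringOfSetsType mu) _ _ aeV aeA.
    move=> [N [mN N0 hN]]; exists N; split => // t nt; apply: hN => -[iVt iAt]; apply: nt.
    apply: eq_trans (Rintegral_subZ_reflect L iAt iVt).
    by apply: eq_Rintegral => x _; exact: vws_integrand_reflect.
rewrite E (lebesgue_RintegralB (RintegrableZl L iA) iV) (lebesgue_RintegralZl L iA).
rewrite (time_derivative_integral T0 tpsi).
move: h0; set V := \int[mu]_t _; set Z := \int[mu]_x psi (x, 0).
move: V Z D => V Z D h0; lra.
Qed.

End reflection.

(** * A smooth bump *)

Section bump.
Context {R : realType} (a1 a2 : R).
Implicit Types (p : {poly R}) (x : R).

Definition bump_poly : {poly R} := ('X - a1%:P) * (a2%:P - 'X).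
Local Notation w := bump_poly.

Lemma bump_polyE x : w.[x] = (x - a1) * (a2 - x).
Proof. by rewrite /bump_poly !hornerE. Qed.

Lemma bump_poly_gt0 x : a1 < a2 -> (0 < w.[x]) = (a1 < x) && (x < a2).
Proof.
move=> a12; rewrite bump_polyE; have [ax|xa] := ltP a1 x.
  by rewrite pmulr_rgt0 ?subr_gt0.
apply/negbTE; rewrite -leNgt mulr_le0_ge0 ?subr_le0// subr_ge0.
exact: le_trans xa (ltW a12).
Qed.

(** The functions p w^-n e^(-1/w) on ]a1, a2[, extended by 0, where w vanishes
    at a1 and a2. The family is closed under differentiation, which gives
    smoothness by induction; its member 1, 0 is the usual bump. *)
Definition bump p (n : nat) x : R :=
  if 0 < w.[x] then p.[x] * (w.[x])^-1 ^+ n * expR (- (w.[x])^-1) else 0.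

(** The polynomial p' w^2 - n p w' w + p w' is what the derivative of p w^-n
    e^(-1/w) leaves after factoring out w^-(n+2) e^(-1/w). *)
Definition bump_step p (n : nat) : {poly R} :=
  p^`() * w ^+ 2 - n%:R *: (p * w^`() * w) + p * w^`().

(** One term of the exponential series of 1/u. *)
Lemma expR_inv_le (u : R) (m : nat) : 0 < u -> expR (- u^-1) <= m.+1`!%:R * u ^+ m.+1.
Proof.
move=> u0; have ui0 : 0 <= u^-1 by rewrite invr_ge0 ltW.
have f0 : 0 < m.+1`!%:R :> R by rewrite ltr0n fact_gt0.
have h : (m.+1`!%:R * u ^+ m.+1)^-1 <= expR (u^-1).
  apply: le_trans (expR_ge1Dxn m ui0).
  rewrite invfM mulrC exprVn -[leLHS]add0r lerD2r//.
rewrite expRN -[leRHS]invrK lef_pV2 ?posrE ?expR_gt0// invr_gt0.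
by rewrite mulr_gt0// exprn_gt0.
Qed.

(** Since w(x) <= 0, the difference w(y) - w(x) dominates w(y). Its square is of
    second order in y - x, because w is a polynomial. *)
Lemma bump_le p n x y : w.[x] <= 0 ->
  `|bump p n y| <= `|p.[y]| * (n.+2`!%:R * (w.[y] - w.[x]) ^+ 2).
Proof.
move=> wx; rewrite /bump; case: ifPn => [wy|_]; last first.
  by rewrite normr0 mulr_ge0// mulr_ge0// ?sqr_ge0// ler0n.
rewrite !normrM -mulrA ler_wpM2l// ger0_norm; last by rewrite exprn_ge0// invr_ge0 ltW.
rewrite ger0_norm ?expR_ge0//.
have wyn : w.[y] != 0 by rewrite gt_eqF.
apply: (@le_trans _ _ ((w.[y])^-1 ^+ n * (n.+2`!%:R * w.[y] ^+ n.+2))).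
  by rewrite ler_wpM2l ?expR_inv_le// exprn_ge0// invr_ge0 ltW.
have -> : (w.[y])^-1 ^+ n * (n.+2`!%:R * w.[y] ^+ n.+2) = n.+2`!%:R * w.[y] ^+ 2.
  rewrite mulrCA; congr (_ * _).
  by rewrite -[in LHS]addn2 exprD mulrA -exprMn mulVf// expr1n mul1r.
rewrite ler_wpM2l ?ler0n// ler_pXn2r ?nnegrE//; [by rewrite lerDl oppr_ge0|exact: ltW|].
by rewrite subr_ge0 (le_trans wx)// ltW.
Qed.

(** Where w <= 0 the function is 0, and it is of second order nearby; this
    includes the two end points, at which the formula defining the bump
    switches. *)
Lemma is_derive_bump_flat p n x : w.[x] <= 0 -> is_derive x (1 : R) (bump p n) 0.
Proof.
move=> wx.
have bx : bump p n x = 0 by rewrite /bump ltNge wx.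
suff h : h^-1 *: ((bump p n \o shift x) (h *: (1 : R)) - bump p n x) @[h --> 0^'] --> (0 : R).
  split; first by apply/cvg_ex; exists 0.
  exact/cvg_lim.
pose G (h : R) := `|h| * (`|p.[h + x]| * (n.+2`!%:R * (a1 + a2 - 2 * x - h) ^+ 2)).
have G0 : G h @[h --> 0^'] --> (0 : R).
  have : {for 0, continuous G}.
    apply: cvgM; first exact: norm_continuous.
    apply: cvgM.
      apply: cvg_norm.
      apply: (@continuous_comp _ _ _ (fun h : R => h + x) (fun y => p.[y])); last exact: continuous_horner.
      by apply: cvgD; [exact: cvg_id|exact: cvg_cst].
    apply: cvgMr.
    apply: (@continuous_comp _ _ _ (fun h : R => a1 + a2 - 2 * x - h) (fun y => y ^+ 2)); last exact: exprn_continuous.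
    by apply: cvgB; [exact: cvg_cst|exact: cvg_id].
  have G00 : G 0 = 0 by rewrite /G normr0 mul0r.
  move=> h; have {}h : G h @[h --> (0 : R)] --> G 0 := h.
  rewrite G00 in h.
  by apply: cvg_trans h; apply: cvg_app; exact: nbhs_dnbhs.
apply: norm_cvg0; apply: (squeeze_cvgr _ (cvg_cst 0) G0).
near=> h.
have h0 : h != 0 by near: h; exact: nbhs_dnbhs_neq.
rewrite normr_ge0/= bx subr0 normrZ normfV /G.
have /= b := bump_le p n (h *: (1:R) + x) wx.
rewrite ler_pdivrMl ?normr_gt0//.
apply: (le_trans b).
rewrite !bump_polyE [h *: _]mulr1.
rewrite (_ : (h + x - a1) * (a2 - (h + x)) - (x - a1) * (a2 - x) =
   h * (a1 + a2 - 2 * x - h)); last by ring.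
rewrite exprMn -(real_normK (num_real h)) le_eqVlt; apply/orP; left; apply/eqP.
ring.
Unshelve. all: by end_near. Qed.

Lemma is_derive_bump_pos p n x : 0 < w.[x] ->
  is_derive x (1 : R) (bump p n) (bump (bump_step p n) n.+2 x).
Proof.
move=> wx; have wx0 : w.[x] != 0 by rewrite gt_eqF.
pose F := (horner p * (fun y => (w.[y])^-1) ^+ n) * (fun y => expR (- (w.[y])^-1)).
apply: (@near_eq_is_derive _ _ _ F).
  have : \forall y \near x, 0 < w.[y].
    have := @continuous_horner R w x; rewrite /continuous_at => h.
    exact: (cvgr_gt _ h).
  apply: filterS => y wy.
  have e : ((fun y => (w.[y])^-1) ^+ n : R -> R) y = (w.[y])^-1 ^+ n by rewrite exprfctE.
  by rewrite /bump wy -e.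
have dw := is_derive_poly w x.
have dV : is_derive x (1:R) (fun y => (w.[y])^-1) (- (w.[x] ^- 2) *: w^`().[x]).
  exact: is_deriveV.
have dX := is_deriveX n dV.
have dE := @is_derive1_comp R expR (fun y => - (w.[y])^-1) x _ _ (is_derive_expR _) (is_deriveN dV).
have dF := is_deriveM (is_deriveM (is_derive_poly p x) dX) dE.
apply: (is_derive_eq dF).
have e : ((fun y => (w.[y])^-1) ^+ n : R -> R) x = (w.[x])^-1 ^+ n by rewrite exprfctE.
have e2 : (horner p * (fun y => (w.[y])^-1) ^+ n : R -> R) x = p.[x] * (w.[x])^-1 ^+ n.
  by rewrite -e.
have e3 : (bump_step p n).[x] =
    p^`().[x] * w.[x] ^+ 2 - n%:R * (p.[x] * w^`().[x] * w.[x]) + p.[x] * w^`().[x].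
  by rewrite /bump_step !(hornerD, hornerN, hornerM, hornerZ, horner_exp).
have sE (a b : R) : a *: b = a * b by [].
rewrite e2 e /bump wx e3 !sE [(_ \o _) x]/=.
move: (expR _) (p.[x]) (p^`().[x]) (w^`().[x]) wx0 => E q q' W'.
move: (w.[x]) => W W0.
case: (n) => [|m]; first by rewrite !expr0 !mul0r; field.
by rewrite [_.-1]/= !exprS; field.
Qed.

Lemma is_derive_bump p n x :
  is_derive x (1 : R) (bump p n) (bump (bump_step p n) n.+2 x).
Proof.
have [wx|wx] := ltP 0 w.[x]; first exact: is_derive_bump_pos.
rewrite {2}/bump ltNge wx /=.
exact: is_derive_bump_flat.
Qed.

Lemma is_derive_dir (f : R -> R) (x v d : R) : is_derive x (1 : R) f d ->
  derivable f x v /\ 'D_v f x = v * d.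
Proof.
move=> df; have dif : differentiable f x by apply/derivable1_diffP; case: df.
split; first exact: diff_derivable.
have [_ <-] := df.
rewrite !deriveE// -[v in LHS]mulr1 -[v * 1]/(v *: 1).
by rewrite linearZ.
Qed.

Lemma bumpZ (v : R) p n x : bump (v *: p) n x = v * bump p n x.
Proof.
by rewrite /bump; case: ifP => _; rewrite ?mulr0// hornerZ !mulrA.
Qed.

Lemma smooth_bump p n : smooth (bump p n).
Proof.
move=> k; elim: k p n => [|k IH] p n.
  move=> x; apply: differentiable_continuous; apply/derivable1_diffP.
  by case: (is_derive_bump p n x).
split.
  move=> x; apply: differentiable_continuous; apply/derivable1_diffP.
  by case: (is_derive_bump p n x).
move=> v; split; first by move=> x; exact: (is_derive_dir v (is_derive_bump p n x)).1.
rewrite (_ : (fun x => 'D_v (bump p n) x) = bump (v *: bump_step p n) n.+2).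
  exact: IH.
apply/funext => x; rewrite bumpZ.
exact: (is_derive_dir v (is_derive_bump p n x)).2.
Qed.

Lemma test_function_bump : a1 < a2 -> test_function setT (bump 1 0) /\
  [/\ forall x, 0 <= bump 1 0 x, forall x, a1 < x -> x < a2 -> 0 < bump 1 0 x,
      forall x, x <= a1 -> bump 1 0 x = 0 & forall x, a2 <= x -> bump 1 0 x = 0].
Proof.
move=> a12; split.
  split => //; first exact: smooth_bump.
  apply: (@subclosed_compact _ _ (`[a1, a2]%classic : set R)).
  - exact: closed_closure.
  - exact: segment_compact.
  - have -> : `[a1, a2]%classic = closure (`[a1, a2]%classic : set R).
      by apply/closure_id; exact: itv_closed.
    apply: closure_subset => x /=; rewrite /bump bump_poly_gt0// in_itv/=.
    by case: ifP => [/andP[/ltW-> /ltW->]//|_]; rewrite eqxx.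
split.
- by move=> x; rewrite /bump; case: ifP => // _; rewrite hornerC expr0 !mul1r expR_ge0.
- move=> x ax xa; rewrite /bump bump_poly_gt0// ax xa/=.
  by rewrite hornerC expr0 !mul1r expR_gt0.
- by move=> x xa; rewrite /bump bump_poly_gt0// (ltNge a1) xa.
- by move=> x ax; rewrite /bump bump_poly_gt0// (ltNge x) ax andbF.
Qed.

End bump.

(** * The profiles *)

Section profiles.
Context {R : realType}.
Notation mu := (@lebesgue_measure R).
Notation mu2 := ((@lebesgue_measure R) \x (@lebesgue_measure R))%E.
Implicit Types (s T L P : R) (H U : R -> R).

Lemma ae_witness (Q : R -> Prop) (a b : R) : a < b ->
  {ae mu, forall x, Q x} -> exists x, [/\ a < x, x < b & Q x].
Proof.
move=> ab [N [mN N0 QN]]; apply: contrapT => nx.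
have sub : `]a, b[%classic `<=` N.
  move=> x; rewrite /= in_itv/= => /andP[ax xb]; apply: QN => /= Qx.
  by apply: nx; exists x.
have : (mu `]a, b[%classic <= mu N)%E.
  by apply: le_measure; rewrite ?inE//; exact: measurable_itv.
by rewrite N0 lebesgue_measure_itv/= lte_fin ab -EFinB leNgt lte_fin subr_gt0 ab.
Qed.

Lemma ae_witness2 (Q : R * R -> Prop) (a b c d : R) : a < b -> c < d ->
  {ae mu2, forall p, Q p} ->
  exists p, [/\ a < p.1 < b, c < p.2 < d & Q p].
Proof.
move=> ab cd [N [mN N0 QN]]; apply: contrapT => nx.
have sub : `]a, b[%classic `*` `]c, d[%classic `<=` N.
  move=> p [/=]; rewrite !in_itv/= => p1 p2; apply: QN => /= Qp.
  by apply: nx; exists p.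
have : (mu2 (`]a, b[%classic `*` `]c, d[%classic) <= mu2 N)%E.
  by apply: le_measure; rewrite ?inE//; apply: measurableX; exact: measurable_itv.
have itvE (u v : R) : u < v -> mu `]u, v[%classic = (v - u)%:E.
  by move=> uv; rewrite lebesgue_measure_itv/= lte_fin uv.
have ->: mu2 (`]a, b[%classic `*` `]c, d[%classic) = ((b - a)%:E * (d - c)%:E)%E.
  rewrite -(itvE _ _ ab) -(itvE _ _ cd).
  by apply: product_measure1E; exact: measurable_itv.
by rewrite N0 -EFinM lee_fin leNgt mulr_gt0// subr_gt0.
Qed.

Lemma Phi2_homo L : {homo Phi2 L : x y / x <= y}.
Proof.
move=> x y xy; rewrite /Phi2 lerD//.
  by rewrite ge_max !le_max lexx orbT andbT lerB// orbC.
by rewrite le_min !ge_min lexx orbT andbT xy.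
Qed.

Lemma Phi2_gt0 L r : 0 < L -> 0 < Phi2 L r -> L < r /\ r = Phi2 L r + L.
Proof.
move=> L0; rewrite /Phi2; case: (leP r 0) => r0.
  rewrite (_ : Num.max (r - L) 0 = 0) ?add0r; first by lra.
  by apply/max_idPr; lra.
case: (leP (r - L) 0) => rL; first by rewrite addr0 ltxx.
by rewrite addr0 => _; split; lra.
Qed.

Lemma Phi2_lt0 L r : 0 < L -> Phi2 L r < 0 -> r < 0 /\ r = Phi2 L r.
Proof.
move=> L0; rewrite /Phi2; case: (leP (r - L) 0) => rL.
  rewrite add0r; case: (leP r 0) => r0; last by rewrite ltxx.
  by [].
case: (leP r 0) => r0; last by lra.
lra.
Qed.

(** Phi2(H) is nonincreasing and equals the continuous function U almost
    everywhere. If the two differed at x, points of equality on the suitable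
    side of x would contradict the monotonicity. *)
Lemma temperature_everywhere L H U :
  {homo H : x y / x <= y >-> y <= x} -> temperature_profile (Phi2 L) H U ->
  forall x, U x = Phi2 L (H x).
Proof.
move=> Hd [Uae Uc _] x.
have Vd y z : y <= z -> Phi2 L (H z) <= Phi2 L (H y) by move=> yz; apply/Phi2_homo/Hd.
have [xV|Vx|//] := ltgtP (U x) (Phi2 L (H x)).
  have := cvgr_lt _ (Uc x) _ xV.
  rewrite -nbhs_ballE => -[e /= e0 He].
  (* Here U is below Phi2(H) at x; further left Phi2(H) is even larger. *)
  have [y [y1 y2 Uy]] := ae_witness (ltr_pwDr e0 (lexx (x - e)) : x - e < x - e + e) Uae.
  rewrite subrK in y2.
  have /= := He y; rewrite Uy /ball/= => /(_ ltac:(rewrite gtr0_norm ?subr_gt0//; lra)).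
  by rewrite ltNge Vd// ltW.
have := cvgr_gt _ (Uc x) _ Vx.
rewrite -nbhs_ballE => -[e /= e0 He].
have [y [y1 y2 Uy]] := ae_witness (ltr_pwDr e0 (lexx x) : x < x + e) Uae.
have /= := He y; rewrite Uy /ball/= => /(_ ltac:(rewrite ltr0_norm ?subr_lt0//; lra)).
by rewrite ltNge Vd// ltW.
Qed.

(** Uniqueness identifies h with its reflection, so U(z) + U(-z) = 0 for almost
    all (x, t), where z is the similarity variable. The left-hand side is
    continuous in (x, t) and z takes all real values. *)
Lemma temperature_odd s L P T h H U : 0 < s -> s < 1 -> 0 < L -> 0 < T ->
  the_very_weak_solution s T (Phi2 L) (step_datum L P) h ->
  ae_QT T (fun p => h p = H (p.1 * p.2 `^ (- (2 * s)^-1))) ->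
  (forall x, U x = Phi2 L (H x)) -> continuous U ->
  forall x, U x = - U (- x).
Proof.
move=> s0 s1 L0 T0 [hw huniq] hH UH Uc x.
have hR := huniq _ (very_weak_solution_reflect s0 s1 L0 T0 hw).
have hHf := ae_flip hH.
pose G (p : R * R) := U (p.1 * p.2 `^ (- (2 * s)^-1)) + U (- (p.1 * p.2 `^ (- (2 * s)^-1))).
have aeG : {ae mu2, forall p, QT T p -> G p = 0}.
  have [N1 [mN1 N10 h1]] := hR; have [N2 [mN2 N20 h2]] := hH.
  have [N3 [mN3 N30 h3]] := hHf.
  exists (N1 `|` (N2 `|` N3)); split.
  - by apply: measurableU => //; exact: measurableU.
  - have e23 : mu2 (N2 `|` N3) = 0 by rewrite -N20; exact: measureU0.
    by rewrite -N10; apply: measureU0 => //; exact: measurableU.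
  - move=> p /= np; apply: contrapT => /not_orP[n1 /not_orP[n2 n3]]; apply: np => Qp.
    have e1 : reflect L h p = h p.
      by apply: contrapT => ne; apply: n1; apply: h1 => /= hp; exact/ne/hp.
    have e2 : h p = H (p.1 * p.2 `^ (- (2 * s)^-1)).
      by apply: contrapT => ne; apply: n2; apply: h2 => /= hp; exact/ne/hp.
    have e3 : h (flip p) = H (- p.1 * p.2 `^ (- (2 * s)^-1)).
      apply: contrapT => ne; apply: n3; apply: h3 => /= hp; apply/ne/hp.
      exact/QT_flip.
    move: e1; rewrite /reflect e2 e3 mulNr /G !UH => <-.
    by rewrite Phi2_sub addNr.
apply/eqP; rewrite -addr_eq0; apply: contraT => Gx.
(* x0 is the point whose similarity variable at time t0 is x. *)
pose t0 := T / 2; have t00 : 0 < t0 by rewrite divr_gt0.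
pose x0 := x * t0 `^ ((2 * s)^-1).
have Gx0 : G (x0, t0) = U x + U (- x).
  rewrite /G /x0 /= -mulrA -powRD ?subrr ?powRr0 ?mulr1//.
  by rewrite (gt_eqF t00) implybT.
have cm : {for (x0, t0), continuous (fun p : R * R => p.1 * p.2 `^ (- (2 * s)^-1))}.
  apply: cvgM; first exact: cvg_fst.
  apply: (@continuous_comp _ _ _ snd (fun r : R => r `^ (- (2 * s)^-1))); first exact: cvg_snd.
  apply: differentiable_continuous; apply/derivable1_diffP.
  by have [] := is_derive1_powR (- (2 * s)^-1) t00.
have cG : {for (x0, t0), continuous G}.
  apply: cvgD.
    by apply: (continuous_comp cm); exact: Uc.
  apply: (@continuous_comp _ _ _ (fun p : R * R => - (p.1 * p.2 `^ (- (2 * s)^-1))) U); last exact: Uc.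
  exact: (continuousN cm).
have : nbhs (x0, t0) [set p | G p != 0].
  apply: (cG [set y | y != 0]); rewrite Gx0.
  by apply: open_nbhs_nbhs; split => //; exact: open_neq.
rewrite -nbhs_ballE => -[e /= e0 He].
(* The box of radius e' stays inside the strip, since t0 - e' >= 0 and t0 + e'
   <= T. *)
pose e' := Num.min e t0.
have e'0 : 0 < e' by rewrite lt_min e0.
have e'e : e' <= e by rewrite ge_min lexx.
have e't : e' <= t0 by rewrite ge_min lexx orbT.
have [||p [p1 p2 pQ]] := @ae_witness2 _ (x0 - e') (x0 + e') (t0 - e') (t0 + e') _ _ aeG.
- lra.
- lra.
have QTp : QT T p.
  split => //=; rewrite in_itv/=; move/andP : p2 => [p21 p22].
  have t0T : t0 + t0 = T by rewrite /t0; lra.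
  by apply/andP; split; lra.
have /negP[] : G p != 0.
  apply: He; split => /=.
    by rewrite /ball/= ltr_norml; move/andP : p1 => [? ?]; apply/andP; split; lra.
  by rewrite /ball/= ltr_norml; move/andP : p2 => [? ?]; apply/andP; split; lra.
by rewrite pQ.
Qed.

(** Minus the derivative of H is a nonnegative measure, and the integral is its
    pairing with k >= 0. To see the sign, replace k' by difference quotients and
    move the translation onto H, which then appears through the difference H(x -
    e) - H(x), which is nonnegative. *)
Lemma nonincreasing_integral_derivative_ge0 H (k k' : R -> R) (M B : R) :
  {homo H : x y / x <= y >-> y <= x} -> (forall x, `|H x| <= B) ->
  (forall x : R, is_derive x (1 : R) k (k' x)) -> continuous k' ->
  0 <= M -> vanishes_beyond M k -> (forall x, 0 <= k x) ->
  0 <= \int[mu]_x (H x * k' x).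
Proof.
move=> Hd HB dk ck' M0 sk k0.
have sk' := vanishes_beyond_derive dk sk.
have kc : continuous k.
  by move=> x; apply: differentiable_continuous; apply/derivable1_diffP; case: (dk x).
have mH : measurable_fun setT H by exact: nonincreasing_measurable.
have [K k'K] := continuous_vanishes_bounded ck' sk'.
have K0 : 0 <= K by exact: le_trans (normr_ge0 _) (k'K 0).
have B0 : 0 <= B by exact: le_trans (normr_ge0 _) (HB 0).
pose e (n : nat) : R := n.+1%:R^-1.
have e0 n : 0 < e n by rewrite invr_gt0.
have e1 n : e n <= 1 by rewrite invf_le1// ler1n.
pose D n x := (e n)^-1 * (k (x + e n) - k x).
have DK n x : `|D n x| <= K.
  have xe : x <= x + e n by rewrite lerDl ltW.
  have [c _ E] := @MVT_segment R k k' x (x + e n) xe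
    (fun y _ => dk y) (continuous_subspaceT kc).
  by rewrite /D E addrC addKr mulrC mulfK// gt_eqF.
(* All quotients vanish beyond M + 1, because the increments are at most 1. *)
have sD n : vanishes_beyond (M + 1) (D n).
  move=> x Mx; rewrite /D !sk ?subrr ?mulr0//; first lra.
  have := lerB_normD x (e n); rewrite (gtr0_norm (e0 n)); have := e1 n; lra.
have mD n : measurable_fun setT (D n).
  apply: measurable_funM => //; apply: measurable_funB; last exact: continuous_measurable_fun.
  apply: (measurableT_comp (f := k)); first exact: continuous_measurable_fun.
  exact: measurable_funD.
have lim : \int[mu]_x (H x * D n x) @[n --> \oo] --> \int[mu]_x (H x * k' x).
  have ii := @integrable_indic_itv R (- (M + 1)) (M + 1) true false.
  apply: (lebesgue_cvg_dominated (g := fun x => B * K * \1_(`[- (M + 1), M + 1]%classic : set R) x)).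
  - by move=> n; exact: measurable_funM.
  - by apply: measurable_funM => //; exact: continuous_measurable_fun.
  - move=> x; apply: cvgMr.
    have [dx <-] := dk x.
    have lim0 : h^-1 *: ((k \o shift x) (h *: (1 : R)) - k x) @[h --> 0^'] --> 'D_1 k x by [].
    have en : e n @[n --> \oo] --> (0 : R)^'.
      move=> A [r /= r0 hr].
      have /cvgrPdist_lt /(_ _ r0) := @cvg_harmonic R.
      apply: filterS => n hn; apply: hr => //=.
      by rewrite gt_eqF.
    have := cvg_comp _ _ en lim0.
    apply: cvg_trans; apply: near_eq_cvg; apply: nearW => n /=.
    by rewrite /D (addrC x) /GRing.scale/= mulr1.
  - move=> n x; rewrite normrM -mulrA; apply: ler_pM => //.
    by apply: vanishes_beyond_indic.
  - exact: (RintegrableZl (B * K) ii).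
have ge0 n : 0 <= \int[mu]_x (H x * D n x).
  have iHk c : mu.-integrable setT (EFin \o (fun x => H (x + c) * k x)).
    have [C kC] := continuous_vanishes_bounded kc sk.
    apply: (integrable_vanishes_beyond (M := M) (K := B * C)).
    - apply: measurable_funM; last exact: continuous_measurable_fun.
      apply: (measurableT_comp (f := H)) => //; exact: measurable_funD.
    - by move=> x Mx; rewrite sk// mulr0.
    - by move=> x; rewrite normrM ler_pM.
  have iHk0 : mu.-integrable setT (EFin \o (fun x => H x * k x)).
    by have := iHk 0; rewrite (_ : (fun x => H (x + 0) * k x) = (fun x => H x * k x))//;
      apply/funext => x; rewrite addr0.
  have iHs : mu.-integrable setT (EFin \o (fun x => H x * k (x + e n))).
    have := integrable_shift (e n) (iHk (- e n)).
    by rewrite (_ : (fun x => _) = (fun x => H x * k (x + e n)))//;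
      apply/funext => x; rewrite addrK.
  have -> : \int[mu]_x (H x * D n x) =
      (e n)^-1 * (\int[mu]_x (H x * k (x + e n)) - \int[mu]_x (H x * k x)).
    rewrite -(lebesgue_RintegralB iHs iHk0) -(lebesgue_RintegralZl _ (RintegrableB iHs iHk0)).
    by apply: eq_Rintegral => x _; rewrite /D; ring.
  have -> : \int[mu]_x (H x * k (x + e n)) = \int[mu]_x (H (x + - e n) * k x).
    rewrite -(Rintegral_shift (e n) (iHk (- e n))).
    by apply: eq_Rintegral => x _; rewrite addrK.
  rewrite -(lebesgue_RintegralB (iHk (- e n)) iHk0) mulr_ge0//.
    by rewrite invr_ge0 ltW.
  apply: Rintegral_ge0 => x _; rewrite -mulrBl mulr_ge0// subr_ge0.
  by apply: Hd; rewrite gerDl oppr_le0 ltW.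
rewrite -(cvg_lim (@Rhausdorff R) lim); apply: limr_ge.
  by apply/cvg_ex; eexists; exact: lim.
exact: nearW.
Qed.

Lemma integrable_fraclap M K f s : 0 <= M -> C4_supported M K f -> 0 < s -> s < 1 ->
  mu.-integrable setT (EFin \o fraclap s f).
Proof.
move=> M0 Hf s0 s1.
have [W [iW W0 fW]] := fraclap_dominated s0 s1 M0.
apply: (lebesgue_dominated_integrable _ _ (RintegrableZl K iW)).
  exact: measurable_fraclap (C4_integrable Hf).
by move=> x; exact: fW Hf x.
Qed.

(** Fold the integral at 0: by oddness of U the points x and -x contribute
    together -U(x) ((-Delta)^s f(-x) - (-Delta)^s f(x)), which vanishes for 0 <=
    x <= b and is nonnegative for x >= b by the comparison of potentials. It is
    positive wherever U < 0. *)
Lemma odd_pairing_gt0 s U (f : R -> R) (M K a1 a2 b B : R) : 0 < s -> s < 1 -> 0 <= M ->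
  C4_supported M K f -> 0 < a1 -> a1 < a2 -> a2 < b ->
  (forall y, 0 <= f y) -> (forall y, a1 < y -> y < a2 -> 0 < f y) ->
  (forall y, y <= a1 -> f y = 0) -> (forall y, a2 <= y -> f y = 0) ->
  measurable_fun setT U -> (forall x, `|U x| <= B) ->
  (forall x, U x = - U (- x)) -> (forall x, 0 <= x -> x <= b -> U x = 0) ->
  (forall x, b <= x -> U x <= 0) -> (exists X, forall x, X < x -> U x < 0) ->
  mu.-integrable setT (EFin \o (fun x => U x * fraclap s f x)) /\
  0 < \int[mu]_x (U x * fraclap s f x).
Proof.
move=> s0 s1 M0 Hf a10 a12 a2b f0 fpos fl fr mU UB Uodd U0 Uneg [X UX].
have ifr := integrable_fraclap M0 Hf s0 s1.
have iUf : mu.-integrable setT (EFin \o (fun x => U x * fraclap s f x)).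
  have := integrableM_bounded ifr mU UB.
  by rewrite (_ : (fun x => fraclap s f x * U x) = (fun x => U x * fraclap s f x))//;
    apply/funext => x; rewrite mulrC.
split => //.
have iUf' := integrable_reflect iUf.
have E : \int[mu]_x (U x * fraclap s f x + U (- x) * fraclap s f (- x)) =
    2 * \int[mu]_x (U x * fraclap s f x).
  by rewrite (lebesgue_RintegralD iUf iUf') (Rintegral_reflect iUf); ring.
suff : 0 < \int[mu]_x (U x * fraclap s f x + U (- x) * fraclap s f (- x)) by rewrite E; lra.
have flt x : b <= x -> fraclap s f x < fraclap s f (- x).
  move=> bx; exact: fraclap_antisymmetric_lt M0 Hf s0 s1 a10 a12 a2b bx f0 fpos fl fr.
have NE x : U x * fraclap s f x + U (- x) * fraclap s f (- x) =
    - U x * (fraclap s f (- x) - fraclap s f x).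
  by rewrite (Uodd x) !opprK; ring.
have Npos x : b <= x -> U x < 0 -> 0 < U x * fraclap s f x + U (- x) * fraclap s f (- x).
  by move=> bx Ux; rewrite NE mulr_gt0 ?oppr_gt0// subr_gt0 flt.
have N0 x : 0 <= x -> 0 <= U x * fraclap s f x + U (- x) * fraclap s f (- x).
  move=> x0; have [bx|xb] := leP b x; last by rewrite NE (U0 x x0 (ltW xb)) oppr0 mul0r.
  by rewrite NE mulr_ge0 ?oppr_ge0 ?Uneg// subr_ge0 ltW// flt.
pose X' := Num.max X b.
have X1 : X' < X' + 1 by rewrite ltrDl.
apply: (lebesgue_Rintegral_gt0 X1 (RintegrableD iUf iUf')).
  move=> x; have [x0|x0] := leP 0 x; first exact: N0.
  have := N0 (- x); rewrite opprK addrC; apply; lra.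
move=> x X'x _; move: X'x; rewrite /X' gt_max => /andP[Xx bx].
by apply: Npos; [exact: ltW|exact: UX].
Qed.

(** If U(b) >= 0 with b > 0, then U = 0 on [-b, b] by oddness and monotonicity.
    Test the profile equation with a bump f in ]0, b[. The first term is
    nonnegative since x f(x) >= 0 and H is nonincreasing; the second one is
    positive since U < 0 near infinity, where H tends to -P. Their sum cannot be
    0. *)
Lemma temperature_neg s L P H U :
  0 < s -> s < 1 -> 0 < L -> 0 < P ->
  {homo H : x y / x <= y >-> y <= x} -> bounded_fun H ->
  H x @[x --> +oo] --> - P -> profile_equation s (Phi2 L) H ->
  (forall x, U x = Phi2 L (H x)) -> bounded_fun U ->
  (forall x, U x = - U (- x)) -> forall b, 0 < b -> U b < 0.
Proof.
move=> s0 s1 L0 P0 Hd Hb Hlim Heq UH Ub Uodd b b0.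
have Ud x y : x <= y -> U y <= U x by move=> xy; rewrite !UH; apply/Phi2_homo/Hd.
have U00 : U 0 = 0 by have := Uodd 0; rewrite oppr0; lra.
rewrite ltNge; apply/negP => Ub0.
have mH : measurable_fun setT H by exact: nonincreasing_measurable.
have mU : measurable_fun setT U.
  by apply: nonincreasing_measurable => //; exact: Ud.
have [BH HB] : exists B, forall x, `|H x| <= B.
  have [N [_ hN]] := Hb; exists (N + 1) => x.
  by apply: (hN (N + 1)) => //; rewrite ltrDl.
have [BU UB] : exists B, forall x, `|U x| <= B.
  have [N [_ hN]] := Ub; exists (N + 1) => x.
  by apply: (hN (N + 1)) => //; rewrite ltrDl.
have [X UX] : exists X, forall x, X < x -> U x < 0.
  have P0' : - P < 0 by rewrite oppr_lt0.
  have := cvgr_lt _ Hlim _ P0' => -[X [_ hX]]; exists X => x Xx.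
  rewrite UH; have Hx := hX _ Xx.
  rewrite /Phi2 (_ : Num.max (H x - L) 0 = 0) ?add0r; last by apply/max_idPr; lra.
  by rewrite gt_min Hx.
have a10 : 0 < b / 3 by lra.
have a12 : b / 3 < 2 * b / 3 by lra.
have a2b : 2 * b / 3 < b by lra.
have [tphi [f0 fpos fl fr]] := test_function_bump a12.
set f := bump _ _ _ _ in tphi f0 fpos fl fr.
have [M [K [M0 Hf]]] := test_function_C4 tphi.
have [iUf Uf0] : mu.-integrable setT (EFin \o (fun x => U x * fraclap s f x)) /\
    0 < \int[mu]_x (U x * fraclap s f x).
  apply: (odd_pairing_gt0 s0 s1 M0 Hf a10 a12 a2b f0 fpos fl fr mU UB Uodd); last by exists X.
  - move=> x x0 xb; apply/eqP; rewrite eq_le; apply/andP; split.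
      by rewrite -U00; exact: Ud.
    by apply: (le_trans Ub0); exact: Ud.
  - by move=> x bx; rewrite -U00; apply: Ud; lra.
have [sf cf _] := tphi.
have df (x : R) : is_derive x (1 : R) f ('D_1 f x) by split => //; exact: smooth_derivable.
have cdf : continuous (fun x : R => 'D_1 f x).
  exact: smooth_continuous (@smooth_derive R _ f 1 sf).
(* The function that meets the derivative of H in the profile equation; it is
   nonnegative as f lives on x > 0. *)
pose k x := x * f x; pose k' x := f x + x * 'D_1 f x.
have dk (x : R) : is_derive x (1 : R) k (k' x).
  have := is_deriveM (is_derive_id x (1 : R)) (df x).
  rewrite (_ : _ *: _ + _ = k' x)//.
  by rewrite /k' /GRing.scale/= mulr1 addrC.
have ck' : continuous k'.
  move=> x; apply: cvgD; first exact: (smooth_continuous sf).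
  by apply: cvgM; [exact: cvg_id|exact: cdf].
have sk : vanishes_beyond M k by move=> x Mx; rewrite /k (C4_supp Hf)// mulr0.
have k0 x : 0 <= k x.
  rewrite /k; have [x0|x0] := leP 0 x; first by rewrite mulr_ge0.
  by rewrite fl ?mulr0//; lra.
have Hk := nonincreasing_integral_derivative_ge0 Hd HB dk ck' M0 sk k0.
have sk' := vanishes_beyond_derive dk sk.
have iHk : mu.-integrable setT (EFin \o (fun x => H x * k' x)).
  have := integrableM_bounded (integrable_continuous_vanishes ck' sk') mH HB.
  by rewrite (_ : (fun x => k' x * H x) = (fun x => H x * k' x))//;
    apply/funext => x; rewrite mulrC.
have := Heq f tphi.
have -> : \int[mu]_xi ((2 * s)^-1 * H xi * derive1 (fun x => x * f x) xi +
    Phi2 L (H xi) * fraclap s f xi) =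
  \int[mu]_xi ((2 * s)^-1 * (H xi * k' xi) + U xi * fraclap s f xi).
  apply: eq_Rintegral => x _; rewrite UH -mulrA; congr ((2 * s)^-1 * (H x * _) + _).
  by rewrite derive1E; case: (dk x).
rewrite (lebesgue_RintegralD (RintegrableZl _ iHk) iUf) (lebesgue_RintegralZl _ iHk).
move=> h; have : 0 <= (2 * s)^-1 * \int[mu]_x (H x * k' x).
  by rewrite mulr_ge0// invr_ge0 mulr_ge0// ltW.
move: h Uf0; move: (\int[mu]_x (U x * fraclap s f x)) (_^-1 * _) => u v; lra.
Qed.

End profiles.

Unset Implicit Arguments.

Theorem theorem5p4 (R : realType) (s L P T : R) (h : R * R -> R) (H U : R -> R)
    (s_gt0 : 0 < s) (s_lt1 : s < 1) (L_gt0 : 0 < L) (P_gt0 : 0 < P)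
    (T_gt0 : 0 < T)
    (h_sol : the_very_weak_solution s T (Phi2 L) (step_datum L P) h)
    (H_prof : enthalpy_profile s T (Phi2 L) (L + P) (- P) h H)
    (U_prof : temperature_profile (Phi2 L) H U) :
  ((forall xi : R, U xi = - U (- xi)) /\
   (forall xi : R, xi != 0 -> H xi = - H (- xi) + L)) /\
  (~ {for 0, continuous H} /\
   has_jump H 0 L /\
   (forall xi : R, xi < 0 -> L < H xi) /\
   (forall xi : R, 0 < xi -> H xi < 0) /\
   (forall xi : R, U xi = 0 <-> xi = 0)).
Proof.
have [hH Hb Hd _ Hlim Heq] := H_prof.
have UH := temperature_everywhere Hd U_prof.
have [_ Uc Ub] := U_prof.
have Uodd := temperature_odd s_gt0 s_lt1 L_gt0 T_gt0 h_sol hH UH Uc.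
have Uneg := temperature_neg s_gt0 s_lt1 L_gt0 P_gt0 Hd Hb Hlim Heq UH Ub Uodd.
have Upos x : x < 0 -> 0 < U x.
  by move=> x0; rewrite Uodd oppr_gt0; apply: Uneg; rewrite oppr_gt0.
have U00 : U 0 = 0 by have := Uodd 0; rewrite oppr0; lra.
have Hneg x : x < 0 -> L < H x /\ H x = U x + L.
  by move=> x0; rewrite UH; apply: Phi2_gt0 => //; rewrite -UH; exact: Upos.
have Hpos x : 0 < x -> H x < 0 /\ H x = U x.
  by move=> x0; rewrite UH; apply: Phi2_lt0 => //; rewrite -UH; exact: Uneg.
(* On each side H differs from U by a constant, so its one-sided limits at 0
   come from the continuity of U and U(0) = 0. *)
have liml : H y @[y --> 0^'-] --> L.
  have : U y + L @[y --> 0^'-] --> L.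
    have {2}-> : L = U 0 + L by rewrite U00 add0r.
    apply: cvgD; last exact: cvg_cst.
    by apply: cvg_at_left_filter; exact: Uc.
  apply: cvg_trans; apply: near_eq_cvg; near=> y.
  by rewrite (Hneg y _).2//; near: y; exact: nbhs_left_lt.
have limr : H y @[y --> 0^'+] --> (0 : R).
  have : U y @[y --> 0^'+] --> (0 : R).
    have : U y @[y --> 0^'+] --> U 0 by apply: cvg_at_right_filter; exact: Uc.
    by rewrite U00.
  apply: cvg_trans; apply: near_eq_cvg; near=> y.
  by rewrite (Hpos y _).2//; near: y; exact: nbhs_right_gt.
split; split.
- exact: Uodd.
- move=> x; rewrite neq_lt => /orP[x0|x0].
    have nx : 0 < - x by rewrite oppr_gt0.
    by rewrite (Hneg x x0).2 (Hpos _ nx).2 -Uodd.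
  have nx : - x < 0 by rewrite oppr_lt0.
  rewrite (Hpos x x0).2 (Hneg _ nx).2 Uodd; ring.
- move=> H0.
  have HL : H 0 = L.
    apply: (cvg_unique (@Rhausdorff R) _ liml).
    by apply: cvg_at_left_filter; exact: H0.
  have HR : H 0 = 0.
    apply: (cvg_unique (@Rhausdorff R) _ limr).
    by apply: cvg_at_right_filter; exact: H0.
  by move: L_gt0; rewrite -HL HR ltxx.
- split; first by exists L, 0; split => //; rewrite subr0.
  split; first by move=> x /Hneg[].
  split; first by move=> x /Hpos[].
  move=> x; split => [Ux0|->//].
  have [x0|x0|//] := ltgtP x 0.
    by have := Upos x x0; rewrite Ux0 ltxx.
  by have := Uneg x x0; rewrite Ux0 ltxx.
Unshelve. all: by end_near. Qed.
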